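(* Let $(R,m)$ be a discrete valuation ring containing a field $k$ of characteristic $0$ with a non-zero derivation $D\in\mathrm{Der}_k(R)$, and let $B$ be the integral closure of $R$ in an algebraic extension $F$ of the field of fractions $Q(R)$. Then $\mathrm{Hom}_R(\Omega_{B/k},R)\neq 0$.
   Context: $\Omega_{B/k}$ denotes the module of Kähler differentials of $B$ over $k$. $\mathrm{Der}_k(R)$ is the module of $k$-linear derivations $R\to R$. The algebraic extension $F/Q(R)$ may be infinite. *)

(* Defs.v *)
From HB Require Import structures.
From mathcomp Require Import all_boot all_order all_algebra.
From mathcomp Require Import generic_quotient ring_quotient fraction.
From mathcomp Require Import boolp.
From mathcomp Require Import freeg.

Set Implicit Arguments.
Unset Strict Implicit.
Unset Printing Implicit Defensive.

Import GRing.Theory.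
Local Open Scope ring_scope.
Local Open Scope quotient_scope.

(* -------------------------------------------------------------------- *)
Section DVR.

(* A valuation takes the value +oo at 0; here [v 0] is a junk value and [v]
   is only ever constrained at nonzero arguments. *)
Record discrete_valuation (K : fieldType) (v : K -> int) : Prop :=
  DiscreteValuation {
    dvalM : forall x y, x != 0 -> y != 0 -> v (x * y) = v x + v y;
    dvalD : forall x y, x != 0 -> y != 0 -> x + y != 0 ->
              (Num.min (v x) (v y) <= v (x + y))%R;
    dval_surj : forall n : int, exists2 x, x != 0 & v x = n
  }.

Definition discrete_valuation_ring (R : idomainType) (m : {pred R}) : Prop :=
  exists v : {fraction R} -> int,
  [/\ discrete_valuation v,
      forall x : {fraction R},
        (exists r : R, x = FracField.tofrac r) <-> (x = 0 \/ (0 <= v x)%R)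
    & forall r : R, r \in m <-> (r = 0 \/ (0 < v (FracField.tofrac r))%R)].

End DVR.

(* -------------------------------------------------------------------- *)
(* [A] is regarded as a [k]-algebra through [f]. *)
Definition derivation (k A : comNzRingType) (f : {rmorphism k -> A})
    (M : lmodType A) (d : A -> M) : Prop :=
  [/\ forall a b, d (a + b) = d a + d b,
      forall c a, d (f c * a) = f c *: d a
    & forall a b, d (a * b) = a *: d b + b *: d a].

(* -------------------------------------------------------------------- *)
Section IntegralClosure.
Variables (R : comNzRingType) (F : fieldType) (j : {rmorphism R -> F}).

Definition integral_pred : {pred F} := fun x => `[< integralOver j x >].

Lemma integral_predP x : reflect (integralOver j x) (x \in integral_pred).
Proof. exact: asboolP. Qed.

Lemma integral_pred_subring : subring_closed integral_pred.
Proof.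
split; first exact/integral_predP/integral1.
- by move=> x y /integral_predP hx /integral_predP hy;
    apply/integral_predP/integral_sub.
- by move=> x y /integral_predP hx /integral_predP hy;
    apply/integral_predP/integral_mul.
Qed.

HB.instance Definition _ :=
  GRing.isSubringClosed.Build F integral_pred integral_pred_subring.

Record integral_closure := IntegralClosure {
  intcl_val : F;
  intcl_valP : intcl_val \in integral_pred
}.

HB.instance Definition _ := [isSub for intcl_val].
HB.instance Definition _ := [Choice of integral_closure by <:].
HB.instance Definition _ := [SubChoice_isSubComNzRing of integral_closure by <:].

Lemma intcl_in_subproof r : j r \in integral_pred.
Proof. exact/integral_predP/integral_id. Qed.

Definition intcl_in (r : R) : integral_closure :=
  IntegralClosure (intcl_in_subproof r).

Lemma intcl_in_is_zmod_morphism : zmod_morphism intcl_in.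
Proof. by move=> x y; apply: val_inj; rewrite /= rmorphB. Qed.

Lemma intcl_in_is_monoid_morphism : monoid_morphism intcl_in.
Proof.
by split=> [|x y]; apply: val_inj; rewrite /= ?rmorph1 ?rmorphM.
Qed.

HB.instance Definition _ :=
  GRing.isZmodMorphism.Build R integral_closure intcl_in
    intcl_in_is_zmod_morphism.
HB.instance Definition _ :=
  GRing.isMonoidMorphism.Build R integral_closure intcl_in
    intcl_in_is_monoid_morphism.

End IntegralClosure.

(* -------------------------------------------------------------------- *)
Section Kaehler.
Variables (k B : comNzRingType) (f : {rmorphism k -> B}).

(* The B-submodule of the free module on the symbols <<b>> generated by the
   sum, scalar and Leibniz relations for b |-> <<b>>. *)
Inductive kaehler_rel : {freeg B / B} -> Prop :=
| kaehler_rel_add a b : kaehler_rel (<< a + b >> - << a >> - << b >>)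
| kaehler_rel_scal c a : kaehler_rel (<< f c * a >> - f c *: << a >>)
| kaehler_rel_mul a b : kaehler_rel (<< a * b >> - a *: << b >> - b *: << a >>)
| kaehler_rel0 : kaehler_rel 0
| kaehler_relD u v : kaehler_rel u -> kaehler_rel v -> kaehler_rel (u + v)
| kaehler_relZ a u : kaehler_rel u -> kaehler_rel (a *: u).

Definition kaehler_sub : {pred {freeg B / B}} := fun u => `[< kaehler_rel u >].

Lemma kaehler_subP u : reflect (kaehler_rel u) (u \in kaehler_sub).
Proof. exact: asboolP. Qed.

Lemma kaehler_sub_submod : submod_closed kaehler_sub.
Proof.
split; first exact/kaehler_subP/kaehler_rel0.
move=> a u v /kaehler_subP hu /kaehler_subP hv; apply/kaehler_subP.
by apply: kaehler_relD => //; apply: kaehler_relZ.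
Qed.

HB.instance Definition _ :=
  GRing.isSubmodClosed.Build B {freeg B / B} kaehler_sub kaehler_sub_submod.

Definition kaehler : Type := Quotient.quot kaehler_sub.

HB.instance Definition _ := GRing.Zmodule.on kaehler.
HB.instance Definition _ := EqQuotient.on kaehler.

Let pi_k (u : {freeg B / B}) : kaehler := \pi_(Quotient.quot kaehler_sub) u.

Lemma kaehler_piP u v : pi_k u = pi_k v <-> kaehler_rel (u - v).
Proof.
split=> [h | /kaehler_subP h].
- by apply/kaehler_subP; rewrite Quotient.idealrBE; apply/eqP.
- by apply/eqP; rewrite -[_ == _]Quotient.idealrBE.
Qed.

Lemma kaehler_piD u v : pi_k (u + v) = pi_k u + pi_k v.
Proof. exact: (raddfD (\pi_(Quotient.quot kaehler_sub))). Qed.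

Definition kaehler_scale (b : B) (w : kaehler) : kaehler :=
  pi_k (b *: repr (w : Quotient.quot kaehler_sub)).

Lemma kaehler_scale_pi b u : kaehler_scale b (pi_k u) = pi_k (b *: u).
Proof.
apply/kaehler_piP; rewrite -scalerBr; apply: kaehler_relZ.
by apply/kaehler_piP; rewrite /pi_k reprK.
Qed.

Lemma kaehler_pi_surj (w : kaehler) : exists u, w = pi_k u.
Proof. by exists (repr (w : Quotient.quot kaehler_sub)); rewrite /pi_k reprK. Qed.

Lemma kaehler_scaleA a b w :
  kaehler_scale a (kaehler_scale b w) = kaehler_scale (a * b) w.
Proof.
by have [u ->] := kaehler_pi_surj w; rewrite !kaehler_scale_pi scalerA.
Qed.

Lemma kaehler_scale1 : left_id 1 kaehler_scale.
Proof.
by move=> w; have [u ->] := kaehler_pi_surj w; rewrite kaehler_scale_pi scale1r.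
Qed.

Lemma kaehler_scaleDr : right_distributive kaehler_scale +%R.
Proof.
move=> a w1 w2; have [u1 ->] := kaehler_pi_surj w1.
have [u2 ->] := kaehler_pi_surj w2.
by rewrite -kaehler_piD !kaehler_scale_pi scalerDr kaehler_piD.
Qed.

Lemma kaehler_scaleDl w : {morph kaehler_scale^~ w : a b / a + b}.
Proof.
move=> a b; have [u ->] := kaehler_pi_surj w.
by rewrite !kaehler_scale_pi scalerDl kaehler_piD.
Qed.

HB.instance Definition _ := GRing.Zmodule_isLmodule.Build B kaehler
  kaehler_scaleA kaehler_scale1 kaehler_scaleDr kaehler_scaleDl.

Definition kaehler_d (b : B) : kaehler := pi_k << b >>.

Lemma kaehler_d_derivation : derivation f kaehler_d.
Proof.
split=> [a b | c a | a b]; rewrite /kaehler_d.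
- rewrite -kaehler_piD; apply/kaehler_piP.
  by rewrite opprD addrA; apply: kaehler_rel_add.
- rewrite [RHS]kaehler_scale_pi; apply/kaehler_piP; exact: kaehler_rel_scal.
- rewrite [_ *: pi_k << b >>]kaehler_scale_pi [_ *: pi_k << a >>]kaehler_scale_pi.
  rewrite -kaehler_piD; apply/kaehler_piP.
  by rewrite opprD addrA; apply: kaehler_rel_mul.
Qed.

Lemma kaehler_dP (w : kaehler) :
  exists s : seq (B * B), w = \sum_(x <- s) x.1 *: kaehler_d x.2.
Proof.
have [u ->] := kaehler_pi_surj w.
exists [seq (coeff x u, x) | x <- dom u].
rewrite big_map /= -[in LHS](freeg_sumE u).
elim: (dom u) => [|x s ih].
  by rewrite !big_nil; apply: (raddf0 (\pi_(Quotient.quot kaehler_sub))).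
rewrite !big_cons kaehler_piD ih; congr (_ + _).
rewrite [RHS]kaehler_scale_pi; congr pi_k; apply/eqP/freeg_eqP => y.
by rewrite coeffZ !coeffU mul1r.
Qed.

Lemma kaehler_universal (M : lmodType B) (d : B -> M) : derivation f d ->
  exists2 h : {linear kaehler -> M}, forall b, h (kaehler_d b) = d b
    & forall h' : {linear kaehler -> M},
        (forall b, h' (kaehler_d b) = d b) -> h' =1 h.
Proof.
move=> [dD dZ dM].
pose hA := GRing.isZmodMorphism.Build {freeg B / B} M (fglift d)
  (lift_is_additive d).
pose hl0 : {additive {freeg B / B} -> M} := HB.pack (fglift d) hA.
have lift00 : fglift d 0 = 0 := raddf0 hl0.
have liftD u v : fglift d (u + v) = fglift d u + fglift d v := raddfD hl0 u v.
have liftB u v : fglift d (u - v) = fglift d u - fglift d v := raddfB hl0 u v.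
have liftZ a (u : {freeg B / B}) : fglift d (a *: u) = a *: fglift d u.
  rewrite -(freeg_sumE u); elim: (dom u) => [|x s ih].
    by rewrite !big_nil scaler0 !lift00 scaler0.
  rewrite !big_cons scalerDr !liftD ih scalerDr; congr (_ + _).
  rewrite liftU scalerA -[RHS](liftU d); congr (fglift d _).
  by apply/eqP/freeg_eqP => y; rewrite coeffZ !coeffU mulrA.
have lift0 u : kaehler_rel u -> fglift d u = 0.
  elim=> [a b|c a|a b||u1 u2 _ h1 _ h2|a u1 _ h1];
    rewrite ?liftB ?liftZ ?liftU ?scale1r.
  - by rewrite dD addrAC addrK subrr.
  - by rewrite dZ subrr.
  - by rewrite dM addrAC addrK subrr.
  - exact: lift00.
  - by rewrite liftD h1 h2 addr0.
  - by rewrite h1 scaler0.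
pose h (w : kaehler) : M := fglift d (repr (w : Quotient.quot kaehler_sub)).
have hpi u : h (pi_k u) = fglift d u.
  apply/eqP; rewrite -subr_eq0 -liftB; apply/eqP/lift0.
  by apply/kaehler_piP; rewrite /pi_k reprK.
have hlin : linear h.
  move=> a w1 w2; have [u1 ->] := kaehler_pi_surj w1.
  have [u2 ->] := kaehler_pi_surj w2.
  rewrite [_ *: pi_k u1]kaehler_scale_pi -kaehler_piD !hpi.
  by rewrite liftD liftZ.
pose hL := GRing.isLinear.Build B kaehler M *:%R h hlin.
pose hl : {linear kaehler -> M} := HB.pack h hL.
exists hl => [b | h' h'd w]; first by rewrite /= hpi liftU scale1r.
have hd b : hl (kaehler_d b) = d b by rewrite /= hpi liftU scale1r.
have [s ->] := kaehler_dP w.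
rewrite !linear_sum; apply: eq_bigr => x _.
by rewrite !linearZ h'd hd.
Qed.

End Kaehler.

(* -------------------------------------------------------------------- *)
(* Restriction of scalars of the B-module M along g : R -> B. *)
Section Restriction.
Variables (R B : comNzRingType) (g : {rmorphism R -> B}) (M : lmodType B).

Definition restr of {rmorphism R -> B} : Type := M.

Local Notation M_R := (restr g).

HB.instance Definition _ := GRing.Zmodule.on M_R.

Definition restr_scale (r : R) (w : M_R) : M_R := g r *: (w : M).

Lemma restr_scaleA a b w :
  restr_scale a (restr_scale b w) = restr_scale (a * b) w.
Proof. by rewrite /restr_scale scalerA rmorphM. Qed.

Lemma restr_scale1 : left_id 1 restr_scale.
Proof. by move=> w; rewrite /restr_scale rmorph1 scale1r. Qed.

Lemma restr_scaleDr : right_distributive restr_scale +%R.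
Proof. by move=> a u v; rewrite /restr_scale scalerDr. Qed.

Lemma restr_scaleDl w : {morph restr_scale^~ w : a b / a + b}.
Proof. by move=> a b; rewrite /restr_scale rmorphD scalerDl. Qed.

HB.instance Definition _ := GRing.Zmodule_isLmodule.Build R M_R
  restr_scaleA restr_scale1 restr_scaleDr restr_scaleDl.

End Restriction.

(* -------------------------------------------------------------------- *)
Section Setting.
Variables (k : fieldType) (R : idomainType) (F : fieldType).
Variables (i : {rmorphism k -> R}) (j : {rmorphism {fraction R} -> F}).

Definition frac_closure : comNzRingType :=
  integral_closure (j \o @FracField.tofrac R).

Definition frac_closure_in : {rmorphism R -> frac_closure} :=
  intcl_in (j \o @FracField.tofrac R).

Definition frac_closure_alg : {rmorphism k -> frac_closure} :=
  frac_closure_in \o i.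

End Setting.

(* Main.v *)
Require Import Defs.
From HB Require Import structures.
From mathcomp Require Import all_boot all_order all_algebra.
From mathcomp Require Import generic_quotient ring_quotient fraction.
From mathcomp Require Import separable ring zify.
From mathcomp Require Import boolp freeg classical_sets.

Set Implicit Arguments.
Unset Strict Implicit.
Unset Printing Implicit Defensive.

Import Order.TTheory GRing.Theory Num.Theory.
Local Open Scope ring_scope.

(** Let [K] be the fraction field of [R], [v] its valuation and [t] an element
    of valuation 1. A nonzero [R]-linear map on the differentials of [B] is
    obtained from a derivation of [B] followed by an [R]-linear map from [B] to
    [R].

    The derivation. [D] extends uniquely to [K] and to the algebraic extension [F]
    ([der_ext]), but it need not preserve [B]: for [D = d/dt] the derivative of
    [t^(1/2)] is not integral. Its multiple [t * D] does preserve [B]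
    ([log_der_integral]). It is logarithmic, that is, its value at any nonzero [a]
    of [K] is a multiple of [a] by an element of [R]; and in residue
    characteristic 0 all ramification is tame, so the property passes to every
    valuation ring above [R]. Concretely, if the derivative of some [b] in [B]
    were not integral, a valuation ring [V] containing [B] would miss it
    ([exists_valuation_ring]). From [b] one then produces further elements of
    [V], in the field [K(b)], whose derivatives have larger and larger poles
    ([descent_step]); but on the part of [V] in [K(b)] the derivation has bounded
    denominators ([del_bounded]), as one sees by expressing integral elements
    through powers of [b] with the Gram matrix of the trace form.

    The linear map. An element [x] of [F] is sent to the mean of its conjugates,
    the trace divided by the degree ([ntrace]). This does not depend on a finite
    extension containing [x], so it is defined on all of [F] even if [F] is
    infinite over [K]; it is [K]-linear, because on [K(z)] it is a multiple of
    the trace of a matrix depending linearly on the element ([ntrace_ev]); it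
    sends [B] to [R], by Gauss's lemma and because degrees are invertible in [R]
    ([ntrace_val_int]); and it is the identity on [K]. The composite map
    therefore sends the differential of an [x0] in [R] to [t * D x0], which is
    nonzero for a suitable [x0]. *)

(** * Minimal polynomials in an algebraic extension *)

Section MinimalPolynomial.

Variables (K F : fieldType) (j : {rmorphism K -> F}).
Hypothesis alg : forall x : F, algebraicOver j x.

Local Notation ev x q := (map_poly j q).[x].

Lemma ev_comp x p q : ev x (p \Po q) = ev (ev x q) p.
Proof. by rewrite map_comp_poly horner_comp. Qed.

Lemma exists_minp (x : F) : exists p : {poly K},
  [/\ p \is monic, root (map_poly j p) x
    & forall r, root (map_poly j r) x -> p %| r].
Proof.
pose P n := `[< exists p : {poly K},
  [/\ p != 0, root (map_poly j p) x & size p = n] >].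
have exP : exists n, P n.
  by have [p p0 px] := alg x; exists (size p); apply/asboolP; exists p.
case: (ex_minnP exP) => n /asboolP[p [p0 px sp]] nmin.
have lc0 : (lead_coef p)^-1 != 0 by rewrite invr_eq0 lead_coef_eq0.
exists ((lead_coef p)^-1 *: p); split.
- by rewrite monicE lead_coefZ mulVf // lead_coef_eq0.
- by rewrite map_polyZ /= rootZ // fmorph_eq0.
move=> r rx; rewrite dvdpZl //; apply/modp_eq0P/eqP/contraT => m0.
have mx : root (map_poly j (r %% p)) x.
  have := rx; rewrite {1}(divp_eq r p) rmorphD rmorphM /root hornerD hornerM.
  by rewrite (rootP px) mulr0 add0r.
have := nmin (size (r %% p)); rewrite leqNgt -sp ltn_modp p0 => /(_ _)/negP [] //.
by apply/asboolP; exists (r %% p).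
Qed.

(** The minimal polynomial of [x]; [F] need not be finite over [K], so it is
    chosen from an existence statement instead of computed. *)
Definition minp x : {poly K} := projT1 (cid (exists_minp x)).

Lemma minp_monic x : minp x \is monic.
Proof. by rewrite /minp; case: cid => p []. Qed.

Lemma minp_dvd x r : (minp x %| r) = (ev x r == 0).
Proof.
rewrite /minp; case: cid => p [_ px pmin] /=; apply/idP/idP => [|/pmin//].
by case/dvdpP => q ->; rewrite rmorphM hornerM (rootP px) mulr0.
Qed.

Lemma minp_root x : ev x (minp x) = 0.
Proof. by apply/eqP; rewrite -minp_dvd. Qed.

Lemma minp_size x : (1 < size (minp x))%N.
Proof.
rewrite ltnNge; apply/negP => /size1_polyC e; have := minp_monic x.
have := minp_root x; rewrite e map_polyC hornerC /= => /eqP.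
by rewrite fmorph_eq0 => /eqP ->; rewrite monicE lead_coef0 eq_sym oner_eq0.
Qed.

Lemma minp_irr x : irreducible_poly (minp x).
Proof.
split=> [|q sq qdv]; first exact: minp_size.
have m0 : minp x != 0 by rewrite monic_neq0 // minp_monic.
have [r e] := dvdpP _ _ qdv.
have r0 : r != 0 by apply: contraNneq m0 => r0; rewrite e r0 mul0r.
have q0 : q != 0 by apply: contraNneq m0 => q0; rewrite e q0 mulr0.
have := minp_root x; rewrite {1}e rmorphM hornerM => /eqP.
rewrite mulf_eq0 -!minp_dvd => /orP[] h; last by rewrite /eqp qdv h.
have := dvdp_leq r0 h.
rewrite {1}e size_mul // leqNgt; case: (size q) sq (size_poly_eq0 q) => [|[|n]] //.
  by rewrite (negPf q0).
by move=> _ _; rewrite addnC /= addSn ltnS leq_addl.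
Qed.

Hypothesis char0 : [pchar K] =i pred0.

(** Irreducible polynomials are separable in characteristic 0, since their
    derivative has smaller degree but does not vanish. *)
Lemma minp_separable x : ev x (minp x)^`() != 0.
Proof.
have m0 : minp x != 0 by rewrite monic_neq0 // minp_monic.
rewrite -minp_dvd; apply/negP => h.
have d0 : (minp x)^`() != 0.
  apply/negP => /eqP/polyP/(_ (size (minp x)).-2).
  rewrite coef_deriv coef0 prednK ?ltn_predRL ?minp_size //.
  have := minp_monic x; rewrite monicE lead_coefE => /eqP -> /eqP.
  have /pcharf0P -> := char0.
  by rewrite eqn0Ngt ltn_predRL minp_size.
by have := dvdp_leq d0 h; rewrite leqNgt lt_size_deriv.
Qed.

Lemma natr_size_minp_neq0 x : (size (minp x)).-1%:R != 0 :> K.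
Proof. by have /pcharf0P -> := char0; rewrite -lt0n ltn_predRL minp_size. Qed.

(** The primitive element theorem reduces every statement about two elements of
    [F] to polynomials in a single one, even when [F] is infinite over [K]. *)
Lemma common_primitive x y : exists z q r, x = ev z q /\ y = ev z r.
Proof.
have [p p0 px] := alg x; have [q q0 qy] := alg y.
have [n [[r rx] [s sy]]] := pchar0_PET p0 px q0 qy char0.
by exists (y *+ n - x), r, s.
Qed.

End MinimalPolynomial.

(** * Extending derivations *)

Lemma leibniz1 (A : comNzRingType) (D : A -> A) :
  (forall a b, D (a * b) = a * D b + b * D a) -> D 1 = 0.
Proof.
by move=> h; apply: (addrI (D 1)); have := h 1 1; rewrite !mul1r addr0.
Qed.

(** The value at [q] of the derivation of polynomials that extends [D] and sends
    the variable to [s], after evaluation at [x]. *)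
Definition poly_der (K F : fieldType) (j : {rmorphism K -> F}) (D : K -> K)
  (x s : F) (q : {poly K}) : F :=
  (map_poly j (map_poly D q)).[x] + (map_poly j q^`()).[x] * s.

Section PolynomialDerivation.

Variables (K F : fieldType) (j : {rmorphism K -> F}) (D : K -> K).
Hypothesis D_add : forall a b, D (a + b) = D a + D b.
Hypothesis D_mul : forall a b, D (a * b) = a * D b + b * D a.

Local Notation ev x q := (map_poly j q).[x].

Lemma der0 : D 0 = 0.
Proof. by apply: (addrI (D 0)); rewrite -D_add !addr0. Qed.

Let dE p i : (map_poly D p)`_i = D p`_i.
Proof. exact: coef_map_id0 der0. Qed.

Let D_sum n (f : 'I_n -> K) : D (\sum_i f i) = \sum_i D (f i).
Proof. exact: (big_morph D D_add der0). Qed.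

Lemma map_der_add p q : map_poly D (p + q) = map_poly D p + map_poly D q.
Proof. by apply/polyP => i; rewrite coefD !dE coefD D_add. Qed.

Lemma map_der_mul p q :
  map_poly D (p * q) = p * map_poly D q + q * map_poly D p.
Proof.
apply/polyP => i.
rewrite coefD dE coefM D_sum (coefM p) (coefMr q) -big_split /=.
by apply: eq_bigr => l _; rewrite D_mul !dE.
Qed.

Variables x s : F.
Local Notation pd := (poly_der j D x s).

Lemma poly_der_add p q : pd (p + q) = pd p + pd q.
Proof.
rewrite /poly_der map_der_add derivD !rmorphD !hornerD mulrDl.
by rewrite addrACA.
Qed.

Lemma poly_der_mul p q : pd (p * q) = ev x p * pd q + ev x q * pd p.
Proof.
rewrite /poly_der map_der_mul derivM !rmorphD !rmorphM /= !hornerE.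
by ring.
Qed.

Lemma poly_derC c : pd c%:P = j (D c).
Proof.
rewrite /poly_der derivC rmorph0 horner0 mul0r addr0.
have -> : map_poly D c%:P = (D c)%:P.
  by apply/polyP=> i; rewrite dE !coefC; case: eqP => // _; rewrite der0.
by rewrite map_polyC hornerC.
Qed.

Lemma poly_derX : pd 'X = s.
Proof.
rewrite /poly_der derivX rmorph1 hornerC mul1r.
suff -> : map_poly D 'X = 0 by rewrite rmorph0 horner0 add0r.
by apply/polyP=> i; rewrite dE coefX coef0; case: (i == 1)%N; rewrite ?der0 ?(leibniz1 D_mul).
Qed.

End PolynomialDerivation.

Section DerivationExtension.

Variables (K F : fieldType) (j : {rmorphism K -> F}).
Hypothesis alg : forall x : F, algebraicOver j x.
Hypothesis char0 : [pchar K] =i pred0.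
Variable D : K -> K.
Hypothesis D_add : forall a b, D (a + b) = D a + D b.
Hypothesis D_mul : forall a b, D (a * b) = a * D b + b * D a.

Local Notation ev x q := (map_poly j q).[x].

(** Chain rule: differentiating [p(q)] at [x] is differentiating [p] at [q(x)],
    the variable now being sent to the derivative of [q(x)]. *)
Lemma poly_der_comp x s p q :
  poly_der j D x s (p \Po q) =
  poly_der j D (ev x q) (poly_der j D x s q) p.
Proof.
elim/poly_ind: p => [|p c ih].
  by rewrite comp_poly0 -polyC0 !poly_derC // der0 // rmorph0.
rewrite comp_poly_MXaddC !poly_der_add // !poly_der_mul //.
by rewrite ih ev_comp poly_derX // !poly_derC // map_polyX hornerX.
Qed.

(** The only value compatible with differentiating the relation that says that
    [x] is a root of its minimal polynomial. *)
Definition der_ext x : F :=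
  - ev x (map_poly D (minp alg x)) / ev x (minp alg x)^`().

Lemma der_ext_unique x s : poly_der j D x s (minp alg x) = 0 -> s = der_ext x.
Proof.
have h := minp_separable alg char0 x.
rewrite /poly_der /der_ext => /eqP; rewrite addr_eq0 => /eqP ->.
by rewrite opprK mulrC mulKf.
Qed.

Lemma poly_der_der_ext x p : ev x p = 0 -> poly_der j D x (der_ext x) p = 0.
Proof.
have h := minp_separable alg char0 x.
move/eqP; rewrite -minp_dvd => /dvdpP[q ->].
rewrite poly_der_mul // minp_root mul0r addr0 /poly_der /der_ext.
by rewrite [(map_poly j _^`()).[x] * _]mulrC divfK // subrr mulr0.
Qed.

(** Both sides solve the equation that determines the derivative of [q(z)], by
    the chain rule. Hence on [K(z)] the extension is induced by a derivation of
    polynomials, and inherits additivity and the Leibniz rule. *)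
Lemma der_ext_ev z q : der_ext (ev z q) = poly_der j D z (der_ext z) q.
Proof.
apply/esym/der_ext_unique; rewrite -poly_der_comp poly_der_der_ext //.
by rewrite ev_comp minp_root.
Qed.

Lemma der_ext_add x y : der_ext (x + y) = der_ext x + der_ext y.
Proof.
have [z [q [r [-> ->]]]] := common_primitive alg char0 x y.
by rewrite -hornerD -rmorphD /= !der_ext_ev poly_der_add.
Qed.

Lemma der_ext_mul x y : der_ext (x * y) = x * der_ext y + y * der_ext x.
Proof.
have [z [q [r [-> ->]]]] := common_primitive alg char0 x y.
by rewrite -hornerM -rmorphM /= !der_ext_ev poly_der_mul.
Qed.

Lemma der_ext_base a : der_ext (j a) = j (D a).
Proof.
have <- : ev 0 a%:P = j a by rewrite map_polyC hornerC.
by rewrite der_ext_ev poly_derC.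
Qed.

End DerivationExtension.

(** * The normalized trace *)

(** A polynomial annihilating [A], with matrix coefficients, is divisible by
    ['X - A]; taking determinants bounds the characteristic polynomial. *)
Lemma char_poly_dvd_exp (K : fieldType) n (A : 'M[K]_n.+1) (p : {poly K}) :
  horner_mx A p = 0 -> char_poly A %| p ^+ n.+1.
Proof.
have [phi [[psi phiK psiK] phiZ phiC _]] := mx_poly_ring_isom K n.
move/rootP/factor_theorem => [Q e].
suff -> : p ^+ n.+1 = \det (psi Q) * char_poly A by rewrite dvdp_mull.
rewrite -det_scalar /char_poly -det_mulmx; congr (\det _).
apply: (can_inj phiK); rewrite phiZ e [RHS]rmorphM psiK; congr (_ * _).
by rewrite /char_poly_mx rmorphB phiC phiZ map_polyX.
Qed.

Lemma monic_dvd_irreducible_exp (K : fieldType) (r d : {poly K}) n :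
  irreducible_poly r -> r \is monic -> d \is monic -> d %| r ^+ n ->
  exists e, d = r ^+ e.
Proof.
move=> [sr irr] rm; elim: n d => [|n ih] d dm dvd.
  exists 0%N; apply/eqP; rewrite -eqp_monic ?monic1 //.
  by rewrite /eqp dvd dvd1p.
have [sg | ng] := eqVneq (size (gcdp r d)) 1%N.
  by apply: ih => //; move: dvd; rewrite exprS Gauss_dvdpr // coprimep_sym
    coprimep_def sg.
have /andP[_ rg] := irr _ ng (dvdp_gcdl _ _).
have [q e] := dvdpP _ _ (dvdp_trans rg (dvdp_gcdr r d)).
have r0 : r != 0 by rewrite monic_neq0.
have [||k qk] := ih q.
- by move: dm; rewrite e monicMr.
- by move: dvd; rewrite e exprSr dvdp_mul2r.
by exists k.+1; rewrite e qk exprSr.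
Qed.

(** The subleading coefficient turns products of monic polynomials into sums; it
    is minus the sum of the roots. *)
Lemma coef_mul_sublead (R : comNzRingType) (p q : {poly R}) m n :
  (size p <= m.+2)%N -> (size q <= n.+2)%N ->
  (p * q)`_(m + n).+1 = p`_m.+1 * q`_n + p`_m * q`_n.+1.
Proof.
move=> sp sq; rewrite coefM.
have hm : (m < (m + n).+2)%N by lia.
have hm1 : (m.+1 < (m + n).+2)%N by lia.
rewrite (bigD1 (Ordinal hm1)) //= (bigD1 (Ordinal hm)) /=; last first.
  by rewrite -val_eqE /=; lia.
have -> : ((m + n).+1 - m.+1 = n)%N by lia.
have -> : ((m + n).+1 - m = n.+1)%N by lia.
rewrite big1 ?addr0 // => i; rewrite -!val_eqE /= => /andP[i1 i2].
have [im|im] := leqP i m.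
  by rewrite [q`__]nth_default ?mulr0 //; apply: leq_trans sq _; lia.
by rewrite [p`__]nth_default ?mul0r //; apply: leq_trans sp _; lia.
Qed.

Lemma sublead_exp (R : comNzRingType) (r : {poly R}) m e :
  r \is monic -> size r = m.+2 ->
  size (r ^+ e.+1) = (m.+1 * e.+1).+1 /\
  (r ^+ e.+1)`_(m.+1 * e.+1).-1 = r`_m *+ e.+1.
Proof.
move=> rm sr; elim: e => [|e [ihs ih]].
  by rewrite expr1 muln1 mulr1n.
have rem : r ^+ e.+1 \is monic by rewrite monic_exp.
have le1 : (r ^+ e.+1)`_(m.+1 * e.+1) = 1.
  by move/monicP: rem; rewrite lead_coefE ihs.
have lr1 : r`_m.+1 = 1 by move/monicP: rm; rewrite lead_coefE sr.
split; first by rewrite exprS size_monicM ?monic_neq0 // sr ihs; lia.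
have [n en] : exists n, (m.+1 * e.+1)%N = n.+1 by exists (m.+1 * e.+1).-1; lia.
have -> : ((m.+1 * e.+2).-1 = (m + n).+1)%N by rewrite mulnS en; lia.
rewrite exprS coef_mul_sublead ?sr ?ihs ?en // lr1 mul1r -en le1 mulr1.
by move: ih; rewrite en /= => ->; rewrite addrC -mulrS.
Qed.

(** All eigenvalues of [A] are roots of the irreducible [r], each with the same
    multiplicity, so their mean is the mean of the roots of [r]. *)
Lemma mean_eigenvalue (K : fieldType) n (A : 'M[K]_n.+1) (r : {poly K}) :
  [pchar K] =i pred0 -> irreducible_poly r -> r \is monic ->
  horner_mx A r = 0 ->
  \tr A / n.+1%:R = - r`_(size r).-2 / (size r).-1%:R.
Proof.
move=> char0 irr rm Ar.
have [[|e] ce] := monic_dvd_irreducible_exp irr rm (char_poly_monic A)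
  (char_poly_dvd_exp Ar).
  by have := size_char_poly A; rewrite ce expr0 size_poly1.
have [m sr] : exists m, size r = m.+2.
  by exists (size r).-2; have [+ _] := irr; case: (size r) => [|[]].
have [s1 s2] := sublead_exp e rm sr.
have en : (m.+1 * e.+1 = n.+1)%N by have := size_char_poly A; rewrite ce s1; lia.
rewrite en in s2.
have := char_poly_trace A (ltn0Sn n); rewrite ce s2 => /eqP.
rewrite eq_sym eqr_oppLR => /eqP ->; rewrite -en.
have nz k : k.+1%:R != 0 :> K by have /pcharf0P -> := char0.
rewrite sr /= natrM -[r`_m *+ e.+1]mulr_natr; move: (nz e) (nz m).
move: (e.+1%:R) (m.+1%:R) => a b a0 b0.
by field; rewrite a0 b0.
Qed.

Section NormalizedTrace.

Variables (K F : fieldType) (j : {rmorphism K -> F}).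
Hypothesis alg : forall x : F, algebraicOver j x.
Hypothesis char0 : [pchar K] =i pred0.

Local Notation ev x q := (map_poly j q).[x].
Local Notation minp := (minp alg).

(** The mean of the conjugates of [x], i.e. its trace from any finite extension
    divided by the degree. *)
Definition ntrace (x : F) : K :=
  - (minp x)`_(size (minp x)).-2 / (size (minp x)).-1%:R.

Lemma exists_companion z :
  exists n (C : 'M[K]_n.+1), char_poly C = minp z.
Proof.
have := companionmxK (minp_monic alg z); move: (companionmx _).
case: (_.-1) (minp_size alg z) => [|n] // s C e; last by exists n, C.
by move: s; rewrite -e /char_poly det_mx00 size_poly1.
Qed.

Lemma horner_companion_minp z n (C : 'M[K]_n.+1) q : char_poly C = minp z ->
  horner_mx (horner_mx C q) (minp (ev z q)) = 0.
Proof.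
move=> cC; have /dvdpP[s e] : minp z %| minp (ev z q) \Po q.
  by rewrite minp_dvd ev_comp minp_root.
have <- : horner_mx C (minp (ev z q) \Po q) =
    horner_mx (horner_mx C q) (minp (ev z q)).
  elim/poly_ind: (minp _) => [|p c ih]; first by rewrite comp_poly0 !rmorph0.
  rewrite comp_poly_MXaddC !rmorphD !rmorphM /= ih.
  by rewrite !horner_mx_C horner_mx_X.
by rewrite e rmorphM /= -cC Cayley_Hamilton mulr0.
Qed.

(** The degree of [q(z)] divides that of [z]: the characteristic polynomial of
    multiplication by [q(z)] on [K(z)] is a power of its minimal polynomial. *)
Lemma size_minp_ev z q : (size (minp (ev z q)) <= size (minp z))%N.
Proof.
have [n [C cC]] := exists_companion z.
have := char_poly_dvd_exp (horner_companion_minp q cC).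
move/(monic_dvd_irreducible_exp (minp_irr alg _) (minp_monic alg _)).
case/(_ (char_poly_monic _)) => e ce.
rewrite -cC size_char_poly -(size_char_poly (horner_mx C q)).
apply: dvdp_leq; first by rewrite monic_neq0 // char_poly_monic.
case: e ce => [|e ->]; last by rewrite exprS dvdp_mulIl.
by rewrite expr0 => e1; have := size_char_poly (horner_mx C q); rewrite e1 size_poly1.
Qed.

(** Multiplication by [q(z)] on [K(z)] has, in the basis of powers of [z], a
    matrix that is linear in [q]. *)
Lemma ntrace_ev z n (C : 'M[K]_n.+1) q : char_poly C = minp z ->
  ntrace (ev z q) = \tr (horner_mx C q) / n.+1%:R.
Proof.
move=> cC; rewrite (mean_eigenvalue char0 (minp_irr alg (ev z q))) //.
  exact: minp_monic.
exact: horner_companion_minp.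
Qed.

Lemma ntrace_add x y : ntrace (x + y) = ntrace x + ntrace y.
Proof.
have [z [q [r [-> ->]]]] := common_primitive alg char0 x y.
have [n [C cC]] := exists_companion z.
by rewrite -hornerD -rmorphD /= !(ntrace_ev _ cC) !raddfD /= mulrDl.
Qed.

Lemma ntrace_scale a x : ntrace (j a * x) = a * ntrace x.
Proof.
have [n [C cC]] := exists_companion x.
have -> : j a * x = ev x (a *: 'X) by rewrite map_polyZ hornerZ map_polyX hornerX.
transitivity (a * ntrace (ev x 'X)); last by rewrite map_polyX hornerX.
by rewrite !(ntrace_ev _ cC) !linearZ /= mulrA.
Qed.

Lemma ntrace1 : ntrace 1 = 1.
Proof.
have [n [C cC]] := exists_companion 1.
have -> : 1 = ev 1 1 by rewrite rmorph1 hornerC.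
rewrite (ntrace_ev _ cC) rmorph1 mxtrace1 mulfV //.
by have /pcharf0P -> := char0.
Qed.

Lemma ntrace_base a : ntrace (j a) = a.
Proof. by rewrite -[j a]mulr1 ntrace_scale ntrace1 mulr1. Qed.

End NormalizedTrace.

(** * Discrete valuations *)

Section DiscreteValuation.

Variables (K : fieldType) (v : K -> int).
Hypothesis dv : discrete_valuation v.

(** The valuation ring and its maximal ideal; [v 0] carries no information, so
    [0] is put in by hand. *)
Definition val_int (c : K) := (c == 0) || (0 <= v c)%R.
Definition val_max (c : K) := (c == 0) || (0 < v c)%R.

Lemma dval1 : v 1 = 0.
Proof.
have := dvalM dv (oner_neq0 K) (oner_neq0 K); rewrite mulr1 => e.
by apply: (addrI (v 1)); rewrite -e addr0.
Qed.

Lemma dvalV x : x != 0 -> v x^-1 = - v x.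
Proof.
move=> x0; apply: (addrI (v x)).
by rewrite -dvalM ?invr_eq0 // mulfV // dval1 subrr.
Qed.

Lemma dval_div x y : x != 0 -> y != 0 -> v (x / y) = v x - v y.
Proof. by move=> x0 y0; rewrite dvalM ?invr_eq0 // dvalV. Qed.

Lemma dval_exp x n : x != 0 -> v (x ^+ n) = v x *+ n.
Proof.
move=> x0; elim: n => [|n ih]; first by rewrite expr0 dval1.
by rewrite exprS dvalM ?expf_neq0 // ih mulrS.
Qed.

Lemma dvalN x : x != 0 -> v (- x) = v x.
Proof.
move=> x0; have n0 : (-1 : K) != 0 by rewrite oppr_eq0 oner_eq0.
have : v (-1) + v (-1) = 0 by rewrite -(dvalM dv n0 n0) mulrNN mulr1 dval1.
by move=> h; rewrite -mulN1r dvalM //; lia.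
Qed.

Lemma val_int0 : val_int 0. Proof. by rewrite /val_int eqxx. Qed.
Lemma val_max0 : val_max 0. Proof. by rewrite /val_max eqxx. Qed.
Lemma val_int1 : val_int 1. Proof. by rewrite /val_int dval1 lexx orbT. Qed.

Lemma val_intN c : val_int c -> val_int (- c).
Proof. by rewrite /val_int oppr_eq0; case: (eqVneq c 0) => //= c0; rewrite dvalN. Qed.

Lemma val_maxN c : val_max c -> val_max (- c).
Proof. by rewrite /val_max oppr_eq0; case: (eqVneq c 0) => //= c0; rewrite dvalN. Qed.

Lemma val_intD a b : val_int a -> val_int b -> val_int (a + b).
Proof.
rewrite /val_int; have [->|a0] := eqVneq a 0; first by rewrite add0r.
have [->|b0] := eqVneq b 0; first by rewrite addr0 (negPf a0).
have [//|s0] := eqVneq (a + b) 0 => /= va vb.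
by apply: le_trans (dvalD dv a0 b0 s0); rewrite le_min va vb.
Qed.

Lemma val_maxD a b : val_max a -> val_max b -> val_max (a + b).
Proof.
rewrite /val_max; have [->|a0] := eqVneq a 0; first by rewrite add0r.
have [->|b0] := eqVneq b 0; first by rewrite addr0 (negPf a0).
have [//|s0] := eqVneq (a + b) 0 => /= va vb.
by apply: lt_le_trans (dvalD dv a0 b0 s0); rewrite lt_min va vb.
Qed.

Lemma val_intM a b : val_int a -> val_int b -> val_int (a * b).
Proof.
rewrite /val_int mulf_eq0; have [->|a0] := eqVneq a 0; first by [].
by have [->|b0] := eqVneq b 0; rewrite //= dvalM //; lia.
Qed.

Lemma val_maxM a b : val_max a -> val_int b -> val_max (a * b).
Proof.
rewrite /val_int /val_max mulf_eq0; have [->|a0] := eqVneq a 0; first by [].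
by have [->|b0] := eqVneq b 0; rewrite //= dvalM //; lia.
Qed.

Lemma val_max_sum I (r : seq I) (P : pred I) (f : I -> K) :
  (forall i, P i -> val_max (f i)) -> val_max (\sum_(i <- r | P i) f i).
Proof.
by move=> h; apply: (big_ind val_max); [exact: val_max0 | exact: val_maxD |].
Qed.

Lemma val_int_sum I (r : seq I) (P : pred I) (f : I -> K) :
  (forall i, P i -> val_int (f i)) -> val_int (\sum_(i <- r | P i) f i).
Proof.
by move=> h; apply: (big_ind val_int); [exact: val_int0 | exact: val_intD |].
Qed.

Lemma val_int_sign n : val_int ((-1) ^+ n).
Proof.
by rewrite -signr_odd; case: odd; rewrite ?expr0 ?expr1 ?val_intN // val_int1.
Qed.

Lemma val_int_det n (A : 'M[K]_n) :
  (forall i l, val_int (A i l)) -> val_int (\det A).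
Proof.
move=> h; apply: val_int_sum => s _; apply: val_intM; first exact: val_int_sign.
by apply: (big_ind val_int) => //; [exact: val_int1 | exact: val_intM].
Qed.

Lemma val_int_adj n (A : 'M[K]_n) : (forall i l, val_int (A i l)) ->
  forall i l, val_int ((\adj A) i l).
Proof.
move=> h i l; rewrite mxE /cofactor; apply: val_intM; first exact: val_int_sign.
by apply: val_int_det => a b; rewrite !mxE.
Qed.

Lemma val_unitM a b : val_int a -> val_int b -> ~~ val_max a -> ~~ val_max b ->
  ~~ val_max (a * b).
Proof.
rewrite /val_int /val_max mulf_eq0.
have [|a0] := eqVneq a 0; first by [].
have [|b0] := eqVneq b 0; first by [].
by rewrite dvalM //=; lia.
Qed.

(** Dividing by a coefficient of least valuation. *)
Lemma primitive_part (p : {poly K}) : p != 0 ->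
  exists c, [/\ c != 0, forall i, val_int (c *: p)`_i & exists i, (c *: p)`_i = 1].
Proof.
move=> p0; have sp : ((size p).-1 < size p)%N by rewrite ltn_predL lt0n size_poly_eq0.
pose i0 := Ordinal sp.
have h0 : p`_i0 != 0 by rewrite -lead_coefE lead_coef_eq0.
case: (@arg_minP _ _ _ i0 (fun i : 'I_(size p) => p`_i != 0) (fun i => v p`_i) h0).
move=> i pi0 imin; exists (p`_i)^-1; split; first by rewrite invr_eq0.
  move=> l; rewrite coefZ; have [ls|ls] := ltnP l (size p); last first.
    by rewrite [p`_l]nth_default // mulr0 val_int0.
  have [->|pl0] := eqVneq p`_l 0; first by rewrite mulr0 val_int0.
  rewrite /val_int dvalM ?invr_eq0 // dvalV //.
  by have := imin (Ordinal ls) pl0; rewrite /=; lia.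
by exists i; rewrite coefZ mulVf.
Qed.

Definition val_prim (p : {poly K}) :=
  (forall i, val_int p`_i) /\ exists i, ~~ val_max p`_i.

(** The product of the first coefficients of [p] and [q] that are units is, up to
    the maximal ideal, a coefficient of [p * q]. *)
Lemma val_prim_mul p q : val_prim p -> val_prim q ->
  exists i, ~~ val_max (p * q)`_i.
Proof.
move=> [ip exp] [iq exq].
case: (ex_minnP exp) => m pm mmin; case: (ex_minnP exq) => n qn nmin.
exists (m + n)%N; rewrite coefM.
have hm : (m < (m + n).+1)%N by lia.
rewrite (bigD1 (Ordinal hm)) //= addKn; set s := \sum_(i < _ | _) _.
have ms : val_max s.
  apply: val_max_sum => i; rewrite -val_eqE /= => im.
  have [lt|le] := ltnP i m.
    rewrite val_maxM //; apply: contraT => /mmin.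
    by rewrite leqNgt lt.
  rewrite mulrC val_maxM //; apply: contraT => /nmin.
  by have := ltn_ord i; lia.
apply/negP => h; have := val_unitM (ip m) (iq n) pm qn; rewrite -[_ * _](addrK s).
by rewrite val_maxD // val_maxN.
Qed.

(** Gauss's lemma: scaling [p] by [c] and [q] by [d] to primitive polynomials
    gives a primitive product, so [c * d] is a unit; as [p] and [q] are monic,
    [c] and [d] are integral, hence units too. *)
Lemma monic_factor_val_int (p q : {poly K}) : p \is monic -> q \is monic ->
  (forall i, val_int (p * q)`_i) -> forall i, val_int p`_i.
Proof.
move=> pm qm ipq.
have not1 : ~~ val_max 1 by rewrite /val_max oner_eq0 dval1 ltxx.
have [c [c0 ic [m cm]]] := primitive_part (monic_neq0 pm).
have [d [d0 id [n dn]]] := primitive_part (monic_neq0 qm).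
have pc : val_prim (c *: p) by split=> //; exists m; rewrite cm.
have pd : val_prim (d *: q) by split=> //; exists n; rewrite dn.
have [l] := val_prim_mul pc pd.
rewrite -scalerAl -scalerAr scalerA coefZ => h.
have vc : (0 <= v c)%R.
  have := ic (size p).-1; rewrite coefZ -lead_coefE (monicP pm) mulr1.
  by rewrite /val_int (negPf c0).
have vd : (0 <= v d)%R.
  have := id (size q).-1; rewrite coefZ -lead_coefE (monicP qm) mulr1.
  by rewrite /val_int (negPf d0).
have vcd : ~~ val_max (c * d) by apply: contra h => h; rewrite val_maxM.
have vc0 : v c = 0.
  by move: vcd; rewrite /val_max mulf_eq0 (negPf c0) (negPf d0) dvalM //=; lia.
move=> i; have -> : p`_i = c^-1 * (c *: p)`_i by rewrite coefZ mulKf.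
by rewrite val_intM // /val_int dvalV // vc0 oppr0 lexx orbT.
Qed.

End DiscreteValuation.

Section IntegralTrace.

Variables (R : comNzRingType) (K F : fieldType).
Variables (iota : {rmorphism R -> K}) (j : {rmorphism K -> F}) (v : K -> int).
Hypothesis dv : discrete_valuation v.
Hypothesis intP : forall x, (exists r, x = iota r) <-> (x = 0 \/ (0 <= v x)%R).
Hypothesis v_nat : forall n, v n.+1%:R = 0.
Hypothesis alg : forall x : F, algebraicOver j x.
Hypothesis char0 : [pchar K] =i pred0.

Lemma val_intP x : reflect (exists r, x = iota r) (val_int v x).
Proof.
apply: (iffP orP) => [[/eqP ->|vx]|/intP[->|vx]].
- by exists 0; rewrite rmorph0.
- by apply/intP; right.
- by left.
- by right.
Qed.

Lemma val_int_iota r : val_int v (iota r).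
Proof. by apply/val_intP; exists r. Qed.

Lemma minp_val_int x : integralOver (j \o iota) x ->
  forall i, val_int v (minp alg x)`_i.
Proof.
move=> [f fm fx].
have : minp alg x %| map_poly iota f.
  by rewrite minp_dvd -map_poly_comp -rootE.
move/dvdpP => [q e]; have mm := minp_monic alg x.
have fKm : map_poly iota f \is monic by exact: monic_map.
apply: (@monic_factor_val_int _ _ dv _ q) => //.
  by move: fKm; rewrite e monicMr.
by move=> i; rewrite mulrC -e coef_map val_int_iota.
Qed.

(** The degree of [x] is a unit, because the residue field has characteristic 0;
    dividing the trace by it does no harm. *)
Lemma ntrace_val_int x : integralOver (j \o iota) x -> val_int v (ntrace alg x).
Proof.
move=> /minp_val_int h; rewrite /ntrace val_intM // ?val_intN //.
rewrite /val_int dvalV //; last exact: natr_size_minp_neq0.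
by case: (size _) (minp_size alg x) => [|[|n]] //= _; rewrite v_nat oppr0 lexx orbT.
Qed.

End IntegralTrace.

(** * Integral elements from the Horner scheme *)

Section HornerTruncations.

Variables (R : comNzRingType) (F : fieldType) (J : {rmorphism R -> F}).
Local Notation integral := (integralOver J).
Local Notation hornerl y := (foldl (fun z a => z * y + a)).

Lemma integral_coefs_MXaddC (P : {poly F}) a :
  {in P : seq F, integralRange J} -> integral a ->
  {in P * 'X + a%:P : seq F, integralRange J}.
Proof.
move=> /integral_poly Pi ai; apply/integral_poly => i.
rewrite coefD coefMX coefC; apply: integral_add; case: (i == 0%N) => //.
exact: integral0.
exact: integral0.
Qed.

(** Multiplying the equation [c y^n + a_1 y^(n-1) + ... = 0] by [c^(n-1)] makes
    it a monic equation for [c * y]. The induction runs through the Horner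
    scheme: [P] is the monic polynomial built so far, and [z] the value reached. *)
Lemma integral_scaled_root c y z s (P : {poly F}) n :
  integral c -> (forall a, a \in s -> integral a) ->
  P \is monic -> (1 < size P)%N -> {in P : seq F, integralRange J} ->
  P.[c * y] = c ^+ n * z -> hornerl y z s = 0 -> integral (c * y).
Proof.
move=> ci; elim: s z P n => [|a s ih] z P n si Pm sP Pi Pz /= h.
  by apply: integral_root_monic Pm _ Pi; rewrite /root Pz h mulr0.
have sPX : size (P * 'X + (c ^+ n.+1 * a)%:P) = (size P).+1.
  by rewrite size_MXaddC (negPf (monic_neq0 Pm)).
apply: (ih (z * y + a) (P * 'X + (c ^+ n.+1 * a)%:P) n.+1) => //.
- by move=> b bs; apply: si; rewrite inE bs orbT.
- rewrite monicE lead_coefE sPX /= coefD coefMX coefC.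
  by rewrite gtn_eqF 1?ltnW // addr0 -lead_coefE.
- by rewrite sPX ltnS ltnW.
- apply: integral_coefs_MXaddC => //; apply: integral_mul.
    elim: n.+1 => [|k ihk]; first by rewrite expr0; apply: integral1.
    by rewrite exprS; apply: integral_mul.
  by apply: si; rewrite inE eqxx.
- by rewrite hornerD hornerMX Pz hornerC exprS; ring.
Qed.

Lemma integral_lead_mul c y s : integral c -> (forall a, a \in s -> integral a) ->
  hornerl y c s = 0 -> integral (c * y).
Proof.
case: s => [|a s] ci si /= h; first by rewrite h mul0r; exact: integral0.
have ai : integral a by apply: si; rewrite inE eqxx.
apply: (@integral_scaled_root c y (c * y + a) s ('X + a%:P) 0%N) => //.
- by move=> b bs; apply: si; rewrite inE bs orbT.
- by rewrite monicXaddC.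
- by rewrite size_XaddC.
- rewrite -[X in X + _]mul1r; apply: integral_coefs_MXaddC => //.
  by apply/integral_poly => i; rewrite coef1; apply: integral_nat.
- by rewrite hornerD hornerX hornerC expr0 mul1r.
Qed.

(** Every value [z] reached by the Horner scheme leads a shorter equation for
    [y], so [z] and [z * y] are integral; and a coefficient is the next value
    minus [z * y]. The predicate [E] keeps track of a subring containing these
    values. *)
Lemma coef_integral_split (E : F -> Prop) y c s a :
  (forall b d, E b -> E d -> E (b + d)) ->
  (forall b d, E b -> E d -> E (b * d)) -> (forall b, E b -> E (- b)) -> E y ->
  E c -> (forall b, b \in s -> E b) ->
  integral c -> (forall b, b \in s -> integral b) -> hornerl y c s = 0 ->
  a \in s -> exists al be, [/\ E al, E be, integral al, integral (al * y)
    & [/\ integral be, integral (be * y) & al + be * y = a]].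
Proof.
move=> ED EM EN Ey; elim: s c => [//|b s ih] c Ec Es ci si h.
have cyi := integral_lead_mul ci si h.
have bi : integral b by apply: si; rewrite inE eqxx.
have Eb : E b by apply: Es; rewrite inE eqxx.
have ai : integral (c * y + b) by apply: integral_add.
have Ea : E (c * y + b) by apply: ED => //; apply: EM.
have ssi d : d \in s -> integral d by move=> ds; apply: si; rewrite inE ds orbT.
have sE d : d \in s -> E d by move=> ds; apply: Es; rewrite inE ds orbT.
rewrite inE => /orP[/eqP ->|as_]; last exact: (ih (c * y + b)).
exists (c * y + b), (- c); split=> //; [exact: EN | | split].
- exact: integral_lead_mul ai ssi h.
- exact: integral_opp.
- by rewrite mulNr; apply: integral_opp.
- by rewrite mulNr addrC addKr.
Qed.

End HornerTruncations.

(** * Subrings and valuation rings of a field *)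

Record subring (F : fieldType) (S : F -> Prop) : Prop := Subring {
  sr1 : S 1;
  srB : forall a b, S a -> S b -> S (a - b);
  srM : forall a b, S a -> S b -> S (a * b)
}.

Section SubringTheory.

Variables (F : fieldType) (S : F -> Prop).
Hypothesis hS : subring S.

Lemma sr0 : S 0. Proof. by rewrite -(subrr 1); apply: srB => //; apply: sr1. Qed.

Lemma srN a : S a -> S (- a).
Proof. by move=> Sa; rewrite -sub0r; apply: srB => //; apply: sr0. Qed.

Lemma srD a b : S a -> S b -> S (a + b).
Proof. by move=> Sa Sb; rewrite -[b]opprK; apply: srB => //; apply: srN. Qed.

Lemma srX a n : S a -> S (a ^+ n).
Proof.
move=> Sa; elim: n => [|n ih]; first by rewrite expr0; apply: sr1.
by rewrite exprS; apply: srM.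
Qed.

Lemma sr_sum I (r : seq I) (P : pred I) (f : I -> F) :
  (forall i, P i -> S (f i)) -> S (\sum_(i <- r | P i) f i).
Proof. by move=> h; apply: (big_ind S); [exact: sr0 | exact: srD |]. Qed.

Lemma sr_horner (p : {poly F}) x : (forall i, S p`_i) -> S x -> S p.[x].
Proof.
move=> Sp Sx; rewrite horner_coef; apply: sr_sum => i _.
by apply: srM => //; apply: srX.
Qed.

End SubringTheory.

Record valuation_ring (F : fieldType) (V : F -> Prop) : Prop := ValuationRing {
  vr_subring : subring V;
  vr_total : forall a, V a \/ V a^-1
}.

(** The maximal ideal of a valuation ring. *)
Definition nonunit (F : fieldType) (V : F -> Prop) (a : F) := a = 0 \/ ~ V a^-1.

Section ValuationRingTheory.

Variables (F : fieldType) (V : F -> Prop).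
Hypothesis VV : valuation_ring V.
Local Notation N := (nonunit V).

Let SV : subring V := vr_subring VV.

Lemma nonunit_vr a : N a -> V a.
Proof. by case=> [->|h]; [apply: (sr0 SV) | case: (vr_total VV a)]. Qed.

Lemma unit_vr a : V a -> ~ N a -> a != 0 /\ V a^-1.
Proof.
move=> Va Na; split; first by apply: contra_notN Na => /eqP ->; left.
by apply: contrapT => h; apply: Na; right.
Qed.

Lemma unit_not_nonunit a : a != 0 -> V a^-1 -> ~ N a.
Proof. by move=> a0 Va [a0'|//]; rewrite a0' eqxx in a0. Qed.

Lemma not_nonunit1 : ~ N 1.
Proof. by apply: unit_not_nonunit; rewrite ?oner_eq0 // invr1; apply: (sr1 SV). Qed.

Lemma not_vr_inv a : ~ V a -> a != 0 /\ N a^-1.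
Proof.
move=> Va; split; last by right; rewrite invrK.
by apply: contra_notN Va => /eqP ->; apply: (sr0 SV).
Qed.

Lemma nonunitM a b : N a -> V b -> N (a * b).
Proof.
move=> Na Vb; have [->|ab0] := eqVneq (a * b) 0; first by left.
right=> h; case: Na => [a0|]; first by rewrite a0 mul0r eqxx in ab0.
apply; have -> : a^-1 = b * (a * b)^-1; last exact: (srM SV).
move: ab0; rewrite mulf_eq0 negb_or => /andP[a0 b0].
by rewrite invfM mulrCA mulfV ?mulr1.
Qed.

Lemma nonunitD a b : N a -> N b -> N (a + b).
Proof.
move=> Na Nb; have [a0|a0] := eqVneq a 0; first by rewrite a0 add0r.
have [b0|b0] := eqVneq b 0; first by rewrite b0 addr0.
have e : a + b = b * (1 + a / b) by rewrite mulrDr mulr1 mulrCA mulfV // mulr1 addrC.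
have e' : a + b = a * (1 + b / a).
  by rewrite mulrDr mulr1 [a * _]mulrCA mulfV ?mulr1.
case: (vr_total VV (a / b)) => h.
  by rewrite e; apply: nonunitM => //; apply: (srD SV) => //; apply: (sr1 SV).
rewrite e'; apply: nonunitM => //; apply: (srD SV); first exact: (sr1 SV).
by rewrite -[b / a]invf_div.
Qed.

Lemma nonunitN a : N a -> N (- a).
Proof.
by move=> h; rewrite -mulrN1; apply: nonunitM => //; apply/(srN SV)/(sr1 SV).
Qed.

Lemma nonunit_sum I (r : seq I) (P : pred I) (f : I -> F) :
  (forall i, P i -> N (f i)) -> N (\sum_(i <- r | P i) f i).
Proof.
by move=> h; apply: (big_ind N) => //; [left | exact: nonunitD].
Qed.

(** Divisibility is a total preorder in a valuation ring. *)
Lemma vr_max (I : eqType) (s : seq I) (f : I -> F) i0 : f i0 != 0 ->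
  exists2 i, f i != 0 & {in i0 :: s, forall k, V (f k / f i)}.
Proof.
move=> f0; elim: s => [|a s [i fi h]].
  by exists i0 => // k; rewrite inE => /eqP ->; rewrite mulfV //; apply: (sr1 SV).
have [Vai|nV] := pselect (V (f a / f i)).
  by exists i => // k; rewrite !inE orbCA => /predU1P[->|ks] //; apply: h.
have [ai0 _] := not_vr_inv nV.
have fa : f a != 0 by apply: contraNneq ai0 => ->; rewrite mul0r.
have Via : V (f i / f a) by case: (vr_total VV (f a / f i)) => //; rewrite invf_div.
exists a => // k; rewrite !inE orbCA => /predU1P[->|ks].
  by rewrite mulfV //; apply: (sr1 SV).
have -> : f k / f a = (f k / f i) * (f i / f a) by rewrite mulrA divfK.
by apply: (srM SV) => //; apply: h.
Qed.

(** A term of least value cannot be cancelled by terms of strictly larger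
    value, so another term shares its value. *)
Lemma vr_sum0 n (f : 'I_n -> F) i0 : f i0 != 0 -> \sum_i f i = 0 ->
  exists i k, [/\ i != k, f i != 0, f k != 0, V (f i / f k) & V (f k / f i)].
Proof.
move=> f0 s0; have [k fk hk'] := @vr_max _ (enum 'I_n) f i0 f0.
have hk i : V (f i / f k) by apply: hk'; rewrite inE mem_enum orbT.
have [[i ik Ni]|no] := pselect (exists2 i, i != k & ~ N (f i / f k)).
  have [ni Vi] := unit_vr (hk i) Ni; exists i, k; split=> //; last by rewrite -invf_div.
  by apply: contraNneq ni => ->; rewrite mul0r.
have : N (\sum_(i | i != k) f i / f k).
  by apply: nonunit_sum => i ik; apply: contrapT => h; apply: no; exists i.
have -> : \sum_(i | i != k) f i / f k = -1.
  rewrite -mulr_suml; move: s0; rewrite (bigD1 k) //= => /eqP.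
  by rewrite addrC addr_eq0 => /eqP ->; rewrite mulNr mulfV.
by move/nonunitN; rewrite opprK => /not_nonunit1.
Qed.

End ValuationRingTheory.

(** * Maximal overrings *)

Section MaximalSubring.

Variable F : fieldType.

Definition adjoin (S : F -> Prop) (y z : F) :=
  exists p : {poly F}, (forall i, S p`_i) /\ p.[y] = z.

Lemma subring_adjoin S y : subring S -> subring (adjoin S y).
Proof.
move=> hS; have S0 := sr0 hS; have [S1 SB SM] := hS; split.
- exists 1; split; last by rewrite hornerC.
  by move=> i; rewrite coef1; case: (i == 0)%N.
- move=> _ _ [p [Sp <-]] [q [Sq <-]]; exists (p - q); split.
    by move=> i; rewrite coefB; apply: SB.
  by rewrite hornerD hornerN.
- move=> _ _ [p [Sp <-]] [q [Sq <-]]; exists (p * q); split.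
    by move=> i; rewrite coefM; apply: sr_sum => // l _; apply: SM.
  by rewrite hornerM.
Qed.

Lemma adjoin_sub S y a : subring S -> S a -> adjoin S y a.
Proof.
move=> hS Sa; exists a%:P; split; last by rewrite hornerC.
by move=> i; rewrite coefC; case: ifP => // _; apply: sr0.
Qed.

Lemma adjoin_gen S y : subring S -> adjoin S y y.
Proof.
move=> hS; exists 'X; split; last by rewrite hornerX.
move=> i; rewrite coefX; case: (i == 1)%N; last exact: sr0.
by case: hS.
Qed.

(** Powers of [al] clear the denominators of an expression of [x] in [y], and
    powers of [be * y] those of an expression in [1/y]. As the two add up to 1,
    each term of a large power of their sum clears one of them. *)
Lemma adjoin_meet S y x al be : subring S ->
  S al -> S (al * y) -> S be -> S (be * y) -> al + be * y = 1 -> y != 0 ->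
  adjoin S y x -> adjoin S y^-1 x -> S x.
Proof.
move=> hS Sa Say Sb Sby e y0 [p [Sp px]] [q [Sq qx]]; have [S1 SB SM] := hS.
have Hp n : (size p <= n)%N -> S (al ^+ n * x).
  move=> sn; rewrite -px horner_coef mulr_sumr.
  apply: sr_sum => // i _.
  have -> : al ^+ n * (p`_i * y ^+ i) = p`_i * (al ^+ (n - i) * (al * y) ^+ i).
    rewrite exprMn [al ^+ (n - i) * _]mulrA -exprD subnK; first by ring.
    by apply: leq_trans sn; apply: ltnW.
  by apply: (SM) => //; apply: (SM); apply: srX.
have Hq n : (size q <= n)%N -> S ((be * y) ^+ n * x).
  move=> sn; rewrite -qx horner_coef mulr_sumr.
  apply: sr_sum => // i _.
  have -> : (be * y) ^+ n * (q`_i * y^-1 ^+ i) =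
      q`_i * ((be * y) ^+ (n - i) * be ^+ i).
    have -> : be ^+ i = (be * y) ^+ i * y^-1 ^+ i.
      by rewrite -exprMn mulfK.
    rewrite [(be * y) ^+ (n - i) * _]mulrA -exprD subnK; first by ring.
    by apply: leq_trans sn; apply: ltnW.
  by apply: (SM) => //; apply: (SM); apply: srX.
set n := size p; set m := size q.
rewrite -[x]mul1r -(expr1n _ (n + m)) -e exprDn mulr_suml.
apply: sr_sum => // i _.
rewrite -mulr_natl -mulrA; apply: (SM).
  elim: 'C(_, _) => [|k ih]; first exact: sr0.
  by rewrite -addn1 natrD; apply: srD.
have [im|mi] := leqP m i.
  rewrite -mulrA; apply: SM; last exact: Hq.
  exact: srX.
rewrite mulrAC; apply: SM; last exact: srX.
by apply: Hp; lia.
Qed.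

Local Open Scope classical_set_scope.

(** Zorn's lemma, on the subrings containing [B] but not [x]. *)
Lemma exists_maximal_subring (B : F -> Prop) (x : F) :
  subring B -> ~ B x ->
  exists V : F -> Prop, [/\ subring V, forall a, B a -> V a, ~ V x
   & forall W : F -> Prop, subring W -> (forall a, V a -> W a) ->
       ~ W x -> forall a, W a -> V a].
Proof.
move=> hB Bx.
(* The first alternative covers the union of the empty chain. *)
pose P (S : set F) := S = set0 \/ [/\ subring S, B `<=` S & ~ S x].
have [A [PA Amax]] : exists A, P A /\ forall C, A `<` C -> ~ P C.
  apply: Zorn_bigcup => C CP tC.
  have [none|] := pselect (forall S, C S -> S = set0).
    left; apply/seteqP; split=> // a [S CS Sa].
    by rewrite (none S CS) in Sa.
  move=> /existsNP[S0 /not_implyP[CS0 S00]].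
  have ne S a : C S -> S a -> [/\ subring S, B `<=` S & ~ S x].
    by move=> CS Sa; case: (CP S CS) => // e; rewrite e in Sa.
  have [a0 S0a0] : exists a, S0 a.
    by apply: contrapT => /forallNP h; apply: S00; apply/seteqP; split=> // a /h.
  have [hS0 BS0 _] := ne _ _ CS0 S0a0.
  have two a b : (\bigcup_(X in C) X) a -> (\bigcup_(X in C) X) b ->
      exists S, [/\ C S, subring S, S a & S b].
    move=> [S CS Sa] [T CT Tb]; have [hS _ _] := ne _ _ CS Sa.
    have [hT _ _] := ne _ _ CT Tb.
    by case: (tC S T CS CT) => h; [exists T | exists S]; split=> //; apply: h.
  right; split.
  - split; first by exists S0 => //; case: hS0.
      by move=> a b /two h /h[S [CS [_ SB _] Sa Sb]]; exists S => //; apply: SB.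
    by move=> a b /two h /h[S [CS [_ _ SM] Sa Sb]]; exists S => //; apply: SM.
  - by move=> a Ba; exists S0 => //; apply: BS0.
  - by move=> [S CS Sx]; have [_ _] := ne _ _ CS Sx.
have PB : P B by right; split.
case: PA => [A0|[hA BA Ax]].
  exfalso; apply: (Amax B) => //; rewrite A0; split=> // h.
  by case: hB => /h.
exists A; split=> // W hW AW Wx a Wa; apply: contrapT => nAa.
apply: (Amax W); first by split=> // h; apply/nAa/h.
by right; split=> // b /BA; apply: AW.
Qed.

End MaximalSubring.

(** * Log derivations preserve the integral closure *)

Section LogDerivation.

Variables (R : comNzRingType) (K F : fieldType).
Variables (iota : {rmorphism R -> K}) (j : {rmorphism K -> F}) (v : K -> int).
Hypothesis dv : discrete_valuation v.
Hypothesis intP : forall x, (exists r, x = iota r) <-> (x = 0 \/ (0 <= v x)%R).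
Hypothesis v_nat : forall n, v n.+1%:R = 0.
Hypothesis alg : forall x : F, algebraicOver j x.
Hypothesis char0 : [pchar K] =i pred0.

Local Notation integral := (integralOver (j \o iota)).
Local Notation ev x q := (map_poly j q).[x].
Local Notation minp := (minp alg).
Local Notation vint := (val_int v).
Local Notation vmax := (val_max v).

Lemma horner_foldl (P : {poly F}) y :
  foldl (fun z a => z * y + a) 0 (rev P) = P.[y].
Proof. by rewrite foldl_rev /horner; elim: (polyseq P) => //= a s ->. Qed.

Lemma integral_base a : vint a -> integral (j a).
Proof. by move/(val_intP intP) => [r ->]; apply: integral_id. Qed.

Lemma primitive_integral_coefs (q : {poly K}) a : (forall i, vint q`_i) ->
  a \in rev (map_poly j q) -> integral a.
Proof.
move=> qi; rewrite mem_rev => /(nthP 0)[i _ <-]; rewrite coef_map.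
exact: integral_base.
Qed.

(** The integral closure of a valuation ring is a Pruefer domain: the
    fractional ideal generated by [1] and [y] is invertible, with inverse
    generated by [al] and [be]. They come from an equation for [y] with
    coefficients in the valuation ring, one of which is 1. *)
Lemma integral_comaximal (E : F -> Prop) y :
  (forall b d, E b -> E d -> E (b + d)) ->
  (forall b d, E b -> E d -> E (b * d)) -> (forall a, E (j a)) -> E y ->
  exists al be, [/\ E al, E be, integral al, integral (al * y)
    & [/\ integral be, integral (be * y) & al + be * y = 1]].
Proof.
move=> ED EM Ej Ey.
have [c [c0 ic [i ci]]] := primitive_part dv (monic_neq0 (minp_monic alg y)).
set q := c *: minp y in ic ci.
have qy : ev y q = 0 by rewrite map_polyZ hornerZ minp_root mulr0.
apply: (@coef_integral_split _ _ _ E y 0 (rev (map_poly j q))) => //.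
- move=> b Eb; have -> : - b = j (-1) * b by rewrite rmorphN1 mulN1r.
  exact: EM.
- by have := Ej 0; rewrite rmorph0.
- by move=> b; rewrite mem_rev => /(nthP 0)[l _ <-]; rewrite coef_map; apply: Ej.
- exact: integral0.
- by move=> b; apply: primitive_integral_coefs.
- by rewrite horner_foldl.
- rewrite mem_rev -(rmorph1 j) -ci -coef_map mem_nth //.
  rewrite ltnNge; apply/negP => /leq_sizeP/(_ i (leqnn i)); rewrite coef_map /= ci.
  by rewrite rmorph1 => /eqP; rewrite oner_eq0.
Qed.

(** The leading coefficient of an equation for [x] over the valuation ring. *)
Lemma integral_denominator x :
  exists c, [/\ c != 0, vint c & integral (j c * x)].
Proof.
have [c [c0 ic _]] := primitive_part dv (monic_neq0 (minp_monic alg x)).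
set q := c *: minp x in ic; exists c.
have qx : ev x q = 0 by rewrite map_polyZ hornerZ minp_root mulr0.
have lq : lead_coef (map_poly j q) = j c.
  by rewrite lead_coef_map lead_coefZ (monicP (minp_monic alg x)) mulr1.
have iq a := @primitive_integral_coefs q a ic.
split=> //.
  have := ic (size (minp x)).-1.
  by rewrite coefZ -lead_coefE (monicP (minp_monic alg x)) mulr1.
case e : (rev (map_poly j q)) (horner_foldl (map_poly j q) x) => [|a s] /=.
  move/(congr1 size): e; rewrite size_rev size_map_poly size_scale //.
  by have := minp_size alg x; case: (size _).
have <- : a = j c.
  by rewrite -lq lead_coefE nth_last -[X in last _ X]revK e rev_cons last_rcons.
rewrite mul0r add0r qx => h; apply: integral_lead_mul h.
  by apply: iq; rewrite e inE eqxx.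
by move=> b bs; apply: iq; rewrite e inE bs orbT.
Qed.

(** Take for [V] a maximal overring of the integral closure that avoids [x]. If
    neither [y] nor [1/y] were in [V], then [x] would lie in both [V[y]] and
    [V[1/y]], hence in [V]. *)
Lemma exists_valuation_ring x : ~ integral x ->
  exists V : F -> Prop, [/\ valuation_ring V, forall a, integral a -> V a & ~ V x].
Proof.
move=> nx; have hB : subring integral.
  by split=> [|a b|a b]; [exact: integral1 | exact: integral_sub
    | exact: integral_mul].
have [V [hV BV Vx Vmax]] := exists_maximal_subring hB nx.
have [V1 VB VM] := hV.
exists V; split=> //; split=> // y; apply: contrapT => /not_orP[ny ny'].
have y0 : y != 0 by apply: contra_notN ny => /eqP ->; apply: sr0.
have key z : ~ V z -> adjoin V z x.
  move=> nz; apply: contrapT => h; apply: nz.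
  apply: (Vmax (adjoin V z)) => //; [exact: subring_adjoin | | exact: adjoin_gen].
  by move=> a; apply: adjoin_sub.
have [al [be [_ _ ai ayi [bi byi e]]]] := @integral_comaximal (fun _ => True) y
  (fun _ _ _ _ => I) (fun _ _ _ _ => I) (fun _ => I) I.
by apply/Vx/(adjoin_meet hV _ _ _ _ e) => //; try exact: BV; apply: key.
Qed.

Section Descent.

Variable V : F -> Prop.
Hypothesis VV : valuation_ring V.
Let SV : subring V := vr_subring VV.
Hypothesis BV : forall a, integral a -> V a.
Hypothesis VnT : exists x, ~ V x.
Local Notation N := (nonunit V).

(** A discrete valuation ring is a maximal proper subring of its field of
    fractions: an element of [V] with negative valuation has a power that
    absorbs every denominator. *)
Lemma vr_base a : V (j a) <-> vint a.
Proof.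
split=> [Va|/integral_base/BV //]; apply: contraT => nva.
have [x Vx] := VnT; have [c [c0 _ cx]] := integral_denominator x.
exfalso; apply: Vx.
move: nva; rewrite /val_int negb_or -ltNge => /andP[a0 va].
have -> : x = j a ^+ `|v c|%N * (j (c * a ^+ `|v c|%N)^-1 * (j c * x)).
  rewrite -rmorphXn /= mulrA mulrA -!rmorphM invfM /=.
  by rewrite mulrCA mulfV ?expf_neq0 // mulr1 mulVf // rmorph1 mul1r.
apply: (srM SV) => //; first exact: (srX SV).
apply: (srM SV) => //; last exact: BV.
apply/BV/integral_base; rewrite /val_int dvalV ?mulf_neq0 ?expf_neq0 //.
rewrite dvalM ?expf_neq0 // dval_exp //; apply/orP; right.
by rewrite -mulr_natr; nia.
Qed.

Lemma nonunit_base a : N (j a) <-> vmax a.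
Proof.
rewrite /nonunit -fmorphV; have [->|a0] := eqVneq a 0.
  by rewrite rmorph0 val_max0; split=> // _; left.
split=> [[/eqP|h]|va].
- by rewrite fmorph_eq0 (negPf a0).
- rewrite /val_max (negPf a0) /= ltNge; apply/negP => va; apply: h.
  by apply/vr_base; rewrite /val_int dvalV // oppr_ge0 va orbT.
right=> /vr_base; move: va; rewrite /val_max /val_int invr_eq0 (negPf a0) dvalV //=.
by lia.
Qed.

(** A polynomial of least degree whose reduction is nonzero and kills the residue
    class of [b]. Its leading coefficient is a unit, for otherwise it could be
    dropped; so its derivative has nonzero reduction, because the residue field
    has characteristic 0, and minimality makes the value at [b] a unit. *)
Lemma residual_separable b : V b -> exists g : {poly K},
  [/\ forall i, vint g`_i, N (ev b g) & ~ N (ev b g^`())].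
Proof.
move=> Vb.
pose P n := `[< exists g : {poly K}, [/\ forall i, vint g`_i, N (ev b g),
  exists i, ~~ vmax g`_i & size g = n] >].
have exP : exists n, P n.
  have [c [c0 ic [i ci]]] := primitive_part dv (monic_neq0 (minp_monic alg b)).
  exists (size (c *: minp b)); apply/asboolP; exists (c *: minp b); split=> //.
    by left; rewrite map_polyZ hornerZ minp_root mulr0.
  by exists i; rewrite ci /val_max oner_eq0 dval1 // ltxx.
case: (ex_minnP exP) => n /asboolP[g [ig Ng [i gi] sg]] nmin.
exists g; split=> // Nd.
have g0 : g != 0 by apply: contraNneq gi => ->; rewrite coef0 val_max0.
have lt_min (h : {poly K}) : (size h < size g)%N -> (forall i, vint h`_i) -> N (ev b h) ->
    forall l, vmax h`_l.
  move=> sh ih Nh l; apply: contraT => hl.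
  have := nmin (size h); rewrite leqNgt -sg sh => /(_ _)/negP[] //.
  by apply/asboolP; exists h; split=> //; exists l.
have lead_unit : ~~ vmax (lead_coef g).
  apply/negP => lm; set m := (size g).-1.
  have sm : size g = m.+1 by rewrite /m prednK // lt0n size_poly_eq0.
  have := lt_min (take_poly m g); rewrite sm ltnS size_take_poly => /(_ isT) H.
  suff : vmax (take_poly m g)`_i.
    rewrite coef_take_poly; case: ltnP => [_|le _]; first by rewrite (negPf gi).
    have [ei|ni] := eqVneq i m; first by move: gi; rewrite ei -lead_coefE lm.
    by move: gi; rewrite nth_default ?val_max0 // sm; lia.
  apply: H => [l|].
    by rewrite coef_take_poly; case: ltnP => // _; rewrite val_int0.
  have -> : take_poly m g = g - lead_coef g *: 'X^m.
    apply/polyP=> l; rewrite coef_take_poly coefB coefZ coefXn.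
    have [lm'|ml|->] := ltngtP l m; rewrite ?mulr0 ?subr0 ?mulr1 //.
      by rewrite nth_default // sm.
    by rewrite lead_coefE subrr.
  rewrite rmorphB hornerD hornerN /= map_polyZ hornerZ map_polyXn hornerXn.
  apply: nonunitD => //; apply: nonunitN => //; apply: nonunitM => //.
    exact/nonunit_base.
  exact: (srX SV).
have sg1 : (1 < size g)%N.
  rewrite ltnNge; apply/negP => /size1_polyC e.
  by move: Ng lead_unit; rewrite e map_polyC hornerC lead_coefC /= => /nonunit_base ->.
have := lt_min _ (lt_size_deriv g0).
move=> /(_ _ Nd (size g).-2) H; move: lead_unit; apply/negP; rewrite negbK.
have -> : lead_coef g = g^`()`_(size g).-2 / (size g).-1%:R.
  rewrite coef_deriv prednK ?ltn_predRL // -lead_coefE -[lead_coef g *+ _]mulr_natr mulfK //.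
  by have /pcharf0P -> := char0; rewrite -lt0n ltn_predRL.
case: (size g) sg1 H => [|[|k]] //= _ H; apply: (val_maxM dv); last first.
  by rewrite /val_int dvalV ?v_nat ?oppr0 ?lexx ?orbT //; have /pcharf0P -> := char0.
apply: H => l; rewrite coef_deriv -mulr_natr; apply: (val_intM dv) => //.
by case: l.+1 => [|l']; rewrite ?val_int0 // /val_int v_nat lexx orbT.
Qed.

(** The value group of [V] is torsion over that of [K], with exponent bounded by
    the degree: two terms of the equation of [y] have the same value. *)
Lemma commensurable y : y != 0 -> exists e a,
  [/\ (0 < e < size (minp y))%N, a != 0, V (y ^+ e / j a) & V (j a / y ^+ e)].
Proof.
move=> y0; pose f (i : 'I_(size (minp y))) := j (minp y)`_i * y ^+ i.
have sm : ((size (minp y)).-1 < size (minp y))%N.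
  by rewrite prednK // ltnW // minp_size.
have f0 : f (Ordinal sm) != 0.
  rewrite /f /= -lead_coefE (monicP (minp_monic alg y)) rmorph1 mul1r.
  exact: expf_neq0.
have fs : \sum_i f i = 0.
  transitivity (ev y (minp y)); last exact: minp_root.
  rewrite horner_coef size_map_poly.
  by apply: eq_bigr => i _; rewrite coef_map.
have [i [k [ik fi fk Vik Vki]]] := vr_sum0 VV f0 fs.
wlog lt_ki : i k ik fi fk Vik Vki / (k < i)%N.
  move=> W; have [lt|lt|/val_inj e] := ltngtP k i.
  - exact: (W i k).
  - by apply: (W k i) => //; rewrite eq_sym.
  - by rewrite e eqxx in ik.
have [hi yi] : (minp y)`_i != 0 /\ y ^+ i != 0.
  by move: fi; rewrite /f mulf_eq0 negb_or fmorph_eq0 => /andP.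
have [hk yk] : (minp y)`_k != 0 /\ y ^+ k != 0.
  by move: fk; rewrite /f mulf_eq0 negb_or fmorph_eq0 => /andP.
have key : y ^+ (i - k) / j ((minp y)`_k / (minp y)`_i) = f i / f k.
  rewrite /f expfB // fmorph_div.
  by field; rewrite ?fmorph_eq0 ?hi ?hk ?yk ?yi ?y0.
exists (i - k)%N, ((minp y)`_k / (minp y)`_i); split.
- by have := ltn_ord i; lia.
- by rewrite mulf_neq0 ?invr_eq0.
- by rewrite key.
- by rewrite -invf_div key invf_div.
Qed.

Variable d : K -> K.
Hypothesis d_add : forall a b, d (a + b) = d a + d b.
Hypothesis d_mul : forall a b, d (a * b) = a * d b + b * d a.
Hypothesis d_log : forall a, a != 0 -> vint (d a / a).

Local Notation del := (der_ext alg d).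

Let delM := der_ext_mul alg char0 d_add d_mul.
Let delJ := der_ext_base alg char0 d_add d_mul.
Let delE := der_ext_ev alg char0 d_add d_mul.

Lemma log_der_int a : vint a -> vint (d a).
Proof.
have [->|a0] := eqVneq a 0; first by rewrite (der0 d_add).
by move=> va; rewrite -[d a](divfK a0) (val_intM dv) ?d_log.
Qed.

Lemma vr_ev b (q : {poly K}) : V b -> (forall i, vint q`_i) -> V (ev b q).
Proof. by move=> Vb qi; apply: sr_horner => // i; rewrite coef_map; apply/vr_base. Qed.

Lemma del0 : del 0 = 0.
Proof. by have := delJ 0; rewrite rmorph0 (der0 d_add) rmorph0. Qed.

Lemma del_exp y n : del (y ^+ n.+1) = n.+1%:R * y ^+ n * del y.
Proof.
elim: n => [|n ih]; first by rewrite expr1 expr0 !mul1r.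
by rewrite exprS delM ih mulrS exprS; ring.
Qed.

(** Let [g] be a residual minimal polynomial of [b], and [y = g(b)]. As [g'(b)] is
    a unit, the derivative of [y] has the same pole as that of [b], while [y] is
    a nonunit. A power [y^e] is an element [a] of [K] times a unit [u], so the
    logarithmic derivative of [u] is, up to a unit, that of [y] plus an element
    of the valuation ring. The pole of the derivative of [u] is therefore that of
    [b] plus the value of [y]; the latter is at least [1/E] times the value of
    [t], since [e <= E]. *)
Lemma descent_step t E b : v t = 1 -> t != 0 -> 
  V b -> ~ V (del b) -> (size (minp b) <= E.+1)%N ->
  exists q, [/\ V (ev b q), ~ V (del (ev b q)) &
    V ((del b / del (ev b q)) ^+ E / j t)].
Proof.
move=> vt t0 Vb Vdb sE.
have [g [ig Ng Nd]] := residual_separable Vb.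
set y := ev b g in Ng; set ga := ev b g^`() in Nd.
have Vga : V ga.
  apply: vr_ev => // i; rewrite coef_deriv -mulr_natr; apply: (val_intM dv) => //.
  by rewrite /val_int v_nat lexx orbT.
have [ga0 Vga'] := unit_vr Vga Nd.
set w := ev b (map_poly d g).
have Vw : V w.
  by apply: vr_ev => // i; rewrite coef_map_id0 ?(der0 d_add) //; apply: log_der_int.
have dy : del y = w + ga * del b by rewrite /y delE.
have Vdy : ~ V (del y).
  move=> h; apply: Vdb; have -> : del b = ga^-1 * (del y - w).
    by rewrite dy addrC addKr mulKf.
  by apply: (srM SV) => //; apply: (srB SV).
have [db0 Ndb] := not_vr_inv VV Vdb; have [dy0 Ndy] := not_vr_inv VV Vdy.
have Vby : V (del b / del y).
  have -> : del b / del y = ga^-1 * (1 - w / del y).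
    by rewrite dy in dy0 *; field; rewrite ga0 dy0.
  apply: (srM SV) => //; apply: (srB SV) => //; first exact: (sr1 SV).
  by apply: (srM SV) => //; apply: nonunit_vr.
have y0 : y != 0 by apply: contra_notN Vdy => /eqP ->; rewrite del0; apply: (sr0 SV).
have [e [a [/andP[e0 es] a0 Vu Vu']]] := commensurable y0.
set u := y ^+ e / j a in Vu.
have ja0 : j a != 0 by rewrite fmorph_eq0.
have u0 : u != 0 by rewrite mulf_neq0 ?invr_eq0 ?expf_neq0.
have Vui : V u^-1 by rewrite invf_div.
have uL : u = ev b (a^-1 *: g ^+ e).
  by rewrite map_polyZ hornerZ rmorphXn /= horner_exp fmorphV mulrC.
have va : (0 < v a)%R.
  have : N (j a).
    have -> : j a = y ^+ e * u^-1 by rewrite invf_div mulrCA mulfV ?expf_neq0 ?mulr1.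
    apply: nonunitM => //; rewrite -(prednK e0) exprS; apply: nonunitM => //.
    by apply: (srX SV) => //; apply: nonunit_vr.
  by rewrite nonunit_base /val_max (negPf a0).
have du : del u = u * (e%:R * (del y / y) - j (d a / a)).
  have : del (y ^+ e) = del (j a * u) by rewrite mulrC divfK.
  rewrite delM delJ -(prednK e0) del_exp prednK // => h.
  have -> : del u = (e%:R * y ^+ e.-1 * del y - u * j (d a)) / j a.
    by rewrite h addrK mulrAC mulfV ?mul1r.
  have ye : y ^+ e = y * y ^+ e.-1 by rewrite -exprS prednK.
  rewrite fmorph_div /u ye.
  by field; rewrite y0 ja0.
have Ve : V e%:R.
  rewrite -(rmorph_nat j); apply/vr_base.
  by rewrite /val_int -(prednK e0) v_nat lexx orbT.
set la := del y / y in du.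
have la0 : la != 0 by rewrite mulf_neq0 ?invr_eq0.
have Nla : N la^-1.
  by rewrite invf_div; apply: nonunitM => //; apply: nonunit_vr.
have Vc : V (j (d a / a)) by apply/vr_base/d_log.
set ep := e%:R - j (d a / a) / la.
have due : del u = u * la * ep.
  rewrite du /ep -mulrA; congr (u * _).
  by rewrite mulrBr [la * (_ / _)]mulrC divfK // mulrC.
have Nep : ~ N ep.
  move=> Nep; have : N e%:R.
    rewrite -[e%:R](subrK (j (d a / a) / la)); apply: nonunitD => //.
    by rewrite mulrC; apply: nonunitM.
  rewrite -(rmorph_nat j) nonunit_base /val_max -(prednK e0) v_nat ltxx orbF.
  by have /pcharf0P -> := char0.
have Vep : V ep by apply: (srB SV) => //; apply: (srM SV) => //; apply: nonunit_vr.
have [ep0 Vep'] := unit_vr Vep Nep.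
exists (a^-1 *: g ^+ e); rewrite -uL; split=> //.
  move=> Vdu; apply: Vdy.
  have -> : del y = y * (u^-1 * ep^-1 * del u).
    by rewrite due /la; field; rewrite y0 u0 ep0.
  apply: (srM SV) => //; first exact: nonunit_vr.
  by apply: (srM SV) => //; apply: (srM SV).
have -> : (del b / del u) ^+ E / j t =
    (u^-1 * ep^-1 * (del b / del y)) ^+ E * (y ^+ (E - e) * u * j (a / t)).
  have -> : y ^+ (E - e) * u * j (a / t) = y ^+ E / j t.
    rewrite /u fmorph_div mulrA -[in RHS](subnK (_ : e <= E)%N) ?exprD.
      by field; rewrite ja0 fmorph_eq0 t0.
    by rewrite -ltnS (leq_trans es) // (leq_trans _ sE) // size_minp_ev.
  rewrite mulrA -exprMn due /la; congr (_ ^+ E / _).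
  by field; rewrite y0 u0 ep0 dy0.
apply: (srM SV) => //; first by apply: (srX SV) => //; apply: (srM SV) => //; apply: (srM SV).
apply: (srM SV) => //; first by apply: (srM SV) => //; apply: (srX SV) => //; apply: nonunit_vr.
apply/vr_base; rewrite /val_int dval_div // vt; lia.
Qed.

Section Bound.

Variable b : F.
Hypothesis b_int : integral b.
Local Notation m := (size (minp b)).-1.

Lemma ev_modp (q : {poly K}) : ev b (q %% minp b) = ev b q.
Proof.
by rewrite {2}(divp_eq q (minp b)) rmorphD rmorphM hornerD hornerM minp_root
  mulr0 add0r.
Qed.

Lemma size_modp_minp (q : {poly K}) : (size (q %% minp b)%R <= m)%N.
Proof.
rewrite -ltnS prednK; first by rewrite ltn_modp monic_neq0 // minp_monic.
by rewrite ltnW // minp_size.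
Qed.

Lemma ntrace_ev_mul (q : {poly K}) w : (size q <= m)%N ->
  ntrace alg (ev b q * w) = \sum_(i < m) q`_i * ntrace alg (b ^+ i * w).
Proof.
move=> sq; have n0 : ntrace alg 0 = 0 by rewrite -(rmorph0 j) ntrace_base.
rewrite (horner_coef_wide _ (n := m)) ?size_map_poly // mulr_suml.
rewrite (big_morph _ (ntrace_add alg char0) n0); apply: eq_bigr => i _.
by rewrite coef_map -mulrA ntrace_scale.
Qed.

(** The Gram matrix of the normalized trace form on the powers of [b]. *)
Definition trace_gram : 'M[K]_m := \matrix_(i, l) ntrace alg (b ^+ i * b ^+ l).

(** An element orthogonal to all powers of [b] is orthogonal to its inverse. *)
Lemma det_trace_gram : \det trace_gram != 0.
Proof.
apply/negP => /det0P[u u0 uG].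
set q := rVpoly u; have sq : (size q <= m)%N by apply: size_poly.
have q0 : q != 0 by apply: contraNneq u0 => e; rewrite -[u]rVpolyK -/q e linear0.
have ort l : (l < m)%N -> ntrace alg (ev b q * b ^+ l) = 0.
  move=> lm; have := congr1 (fun M : 'rV_m => M 0 (Ordinal lm)) uG.
  rewrite !mxE => <-; rewrite ntrace_ev_mul //; apply: eq_bigr => i _.
  by rewrite mxE coef_rVpoly_ord.
have cop : coprimep q (minp b).
  rewrite coprimep_sym coprimep_def; apply: contraT => h.
  have /andP[_ d1] := (minp_irr alg b).2 _ h (dvdp_gcdl _ _).
  have := dvdp_leq q0 (dvdp_trans d1 (dvdp_gcdr _ _)).
  move=> /leq_trans/(_ sq); have := minp_size alg b.
  by case: (size _) => // k _; rewrite ltnn.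
have [[r s] /= e] := Bezout_eq1_coprimepP _ _ cop.
have e1 : ev b q * ev b r = 1.
  rewrite mulrC -hornerM -rmorphM /=.
  have := congr1 (fun p => ev b p) e.
  by rewrite rmorphD !rmorphM hornerD !hornerM minp_root mulr0 addr0 rmorph1 hornerC.
have := ntrace1 alg char0; rewrite -{}e1 mulrC -ev_modp ntrace_ev_mul ?size_modp_minp //.
rewrite big1 => [/eqP|i _]; first by rewrite eq_sym oner_eq0.
by rewrite mulrC [_ ^+ _ * _]mulrC ort ?mul0r.
Qed.

(** Cramer's rule: the products of [q(b)] with the powers of [b] have integral
    traces, and determine the coefficients of [q] through the Gram matrix. *)
Lemma coef_bounded (q : {poly K}) : integral (ev b q) -> (size q <= m)%N ->
  forall i, vint (\det trace_gram * q`_i).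
Proof.
move=> qi sq i; have [im|mi] := ltnP i m; last first.
  by rewrite nth_default ?mulr0 ?val_int0 //; apply: leq_trans mi.
have bX n : integral (b ^+ n).
  elim: n => [|n ih]; first by rewrite expr0; apply: integral1.
  by rewrite exprS; apply: integral_mul.
have tr_int z : integral z -> vint (ntrace alg z).
  exact: ntrace_val_int.
have := congr1 (fun M : 'rV_m => M 0 (Ordinal im))
  (mul_mx_scalar (\det trace_gram) (poly_rV q : 'rV_m)).
rewrite [RHS]mxE [poly_rV q _ _]mxE /= => <-.
rewrite -mul_mx_adj mulmxA mxE; apply: (val_int_sum dv) => l _.
apply: (val_intM dv); last first.
  apply: val_int_adj => // i' l'; rewrite mxE; apply: tr_int.
  exact: integral_mul.
have -> : (poly_rV q *m trace_gram) 0 l = ntrace alg (ev b q * b ^+ l).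
  rewrite ntrace_ev_mul // mxE; apply: eq_bigr => i' _.
  by rewrite !mxE.
by apply/tr_int/integral_mul.
Qed.

(** On polynomials in [b] of bounded degree with coefficients of bounded
    denominators, a derivation has bounded denominators. *)
Lemma del_bounded_int : exists D, D != 0 /\
  forall q : {poly K}, integral (ev b q) -> V (j D * del (ev b q)).
Proof.
have [c [c0 ci cb]] := integral_denominator (del b).
have G0 := det_trace_gram; set G := \det trace_gram in G0.
have Gi : vint G.
  apply: val_int_det => // i l; rewrite mxE; apply: ntrace_val_int => //.
  by rewrite -exprD; elim: (_ + _)%N => [|n ih]; rewrite ?expr0 ?exprS;
    [exact: integral1 | exact: integral_mul].
exists (G ^+ 2 * c); split; first by rewrite mulf_neq0 ?expf_neq0.
move=> q; rewrite -ev_modp; move: (_ %% _) (size_modp_minp q) => {}q sq qi.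
have Gq := coef_bounded qi sq; have Vb := BV b_int.
have -> : j (G ^+ 2 * c) * del (ev b q) =
    ev b ((G ^+ 2 * c) *: map_poly d q) +
    ev b (G ^+ 2 *: q^`()) * (j c * del b).
  by rewrite delE !map_polyZ !hornerZ /poly_der rmorphM /=; ring.
apply: (srD SV) => //; last first.
  apply: (srM SV) => //; last exact: BV.
  apply: vr_ev => // i; rewrite coefZ coef_deriv -[q`__ *+ _]mulr_natr expr2 -mulrA.
  apply: (val_intM dv) => //; rewrite mulrA; apply: (val_intM dv); last first.
    by rewrite /val_int v_nat lexx orbT.
  exact: Gq.
apply: vr_ev => // i; rewrite coefZ coef_map_id0 ?(der0 d_add) //.
have -> : G ^+ 2 * c * d q`_i = c * (G * d (G * q`_i) - G * q`_i * d G).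
  by rewrite d_mul; ring.
apply: (val_intM dv) => //; apply: (val_intD dv).
  by apply: (val_intM dv) => //; apply: log_der_int.
by apply: (val_intN dv); apply: (val_intM dv) => //; apply: log_der_int.
Qed.

(** By comaximality an element of [V] in the field generated by [b] is a quotient
    of two integral elements of that field, with denominator a unit of [V]. *)
Lemma del_bounded : exists D, D != 0 /\
  forall q : {poly K}, V (ev b q) -> V (j D * del (ev b q)).
Proof.
have [D [D0 hD]] := del_bounded_int; exists D; split=> // q Vy.
set y := ev b q in Vy *.
suff [z [r [zu zi zyi zr]]] : exists z r,
    [/\ ~ N z, integral z, integral (z * y) & z = ev b r].
  have [z0 Vz] := unit_vr (BV zi) zu.
  have -> : j D * del y = z^-1 * (j D * del (z * y) - y * (j D * del z)).
    by rewrite delM; field.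
  apply: (srM SV) => //; apply: (srB SV) => //; last first.
    by apply: (srM SV) => //; rewrite zr; apply: hD; rewrite -zr.
  have zy : z * y = ev b (r * q) by rewrite zr /y -hornerM -rmorphM.
  by rewrite zy; apply: hD; rewrite -zy.
have [||a||al [be [[r1 e1] [r2 e2] ai ayi [bi byi e]]]] :=
  @integral_comaximal (fun z => exists r, z = ev b r) y.
- by move=> _ _ [r ->] [s ->]; exists (r + s); rewrite rmorphD hornerD.
- by move=> _ _ [r ->] [s ->]; exists (r * s); rewrite rmorphM hornerM.
- by exists a%:P; rewrite map_polyC hornerC.
- by exists q.
have [Na|Na] := pselect (N al); last by exists al, r1.
exists be, r2; split=> // Nb; apply: (not_nonunit1 VV); rewrite -e.
by apply: nonunitD => //; apply: nonunitM.
Qed.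

End Bound.

End Descent.

Variable d : K -> K.
Hypothesis d_add : forall a b, d (a + b) = d a + d b.
Hypothesis d_mul : forall a b, d (a * b) = a * d b + b * d a.
Hypothesis d_log : forall a, a != 0 -> vint (d a / a).
Local Notation del := (der_ext alg d).

(** Otherwise some valuation ring above the integral closure misses the
    derivative of [b]. Iterating the descent gives elements of [K(b)] in that
    valuation ring whose derivatives have poles growing by a fixed amount,
    against their boundedness. *)
Lemma log_der_integral b : integral b -> integral (del b).
Proof.
move=> bi; apply: contrapT => ndb.
have [V [VV BV Vdb]] := exists_valuation_ring ndb.
have SV := vr_subring VV.
have VnT : exists x, ~ V x by exists (del b).
have [D [D0 hD]] := del_bounded VV BV VnT d_add d_mul d_log bi.
have [t t0 vt] := dval_surj dv 1.
set E := (size (minp b)).-1.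
have descent k : exists q, [/\ V (ev b q), ~ V (del (ev b q)) &
    V ((del (ev b q))^-1 ^+ E / j (t ^+ k))].
  elim: k => [|k [q [Vq Vdq hk]]].
    exists 'X; rewrite map_polyX hornerX expr0 rmorph1 invr1 mulr1.
    split; [exact: BV | exact: Vdb |].
    by apply: (srX SV); case: (vr_total VV (del b)).
  have sq : (size (minp (ev b q)) <= E.+1)%N.
    by rewrite prednK ?size_minp_ev // ltnW // minp_size.
  have [r [Vr Vdr hr]] := descent_step VV BV VnT d_add d_mul d_log vt t0 Vq Vdq sq.
  exists (r \Po q); rewrite ev_comp; split=> //.
  have [dq0 _] := not_vr_inv VV Vdq.
  have -> : (del (ev (ev b q) r))^-1 ^+ E / j (t ^+ k.+1) =
     ((del (ev b q) / del (ev (ev b q) r)) ^+ E / j t) *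
     ((del (ev b q))^-1 ^+ E / j (t ^+ k)).
    rewrite exprS rmorphM mulrACA -exprMn; congr (_ ^+ E * _); last by rewrite invfM.
    by rewrite mulrAC mulfV ?mul1r.
  exact: (srM SV hr hk).
have [q [Vq Vdq]] := descent (`|v D *+ E|.+1)%N.
set k := (`|v D *+ E|.+1)%N => hk.
have [dq0 _] := not_vr_inv VV Vdq.
have : V (j (D ^+ E / t ^+ k)).
  have -> : j (D ^+ E / t ^+ k) = (j D * del (ev b q)) ^+ E *
      ((del (ev b q))^-1 ^+ E / j (t ^+ k)).
    by rewrite mulrA -exprMn mulfK // fmorph_div rmorphXn.
  by apply: (srM SV) => //; apply: (srX SV) => //; apply: hD.
move/(vr_base VV BV VnT).
rewrite /val_int mulf_eq0 invr_eq0 !expf_eq0 (negPf D0) (negPf t0) !andbF /=.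
by rewrite dval_div ?expf_neq0 // !dval_exp // vt /k; lia.
Qed.

End LogDerivation.

(** * Derivations of the field of fractions *)

Section FractionDerivation.

Variables (R : comNzRingType) (K : fieldType) (iota : {rmorphism R -> K}).
Hypothesis fracP : forall x, exists ab : R * R,
  iota ab.2 != 0 /\ x * iota ab.2 = iota ab.1.
Variable D : R -> R.
Hypothesis D_add : forall a b, D (a + b) = D a + D b.
Hypothesis D_mul : forall a b, D (a * b) = a * D b + b * D a.
Hypothesis iota_inj : injective iota.

Definition frac_der (x : K) : K :=
  let ab := projT1 (cid (fracP x)) in
  (iota (D ab.1) - x * iota (D ab.2)) / iota ab.2.

(** Independence of the fraction: apply [D] to [a * b' = a' * b]. *)
Lemma frac_derE x a b : iota b != 0 -> x * iota b = iota a ->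
  frac_der x = (iota (D a) - x * iota (D b)) / iota b.
Proof.
rewrite /frac_der; case: cid => -[a' b'] /= [b'0 e'] b0 e.
have : D (a * b') = D (a' * b).
  congr D; apply: iota_inj; rewrite !rmorphM -e -e'; ring.
rewrite !D_mul => /(congr1 iota); rewrite !rmorphD !rmorphM /= -e -e' => h.
apply/eqP; rewrite eqr_div //; apply/eqP.
apply/eqP; rewrite -subr_eq0; apply/eqP.
have -> : (iota (D a') - x * iota (D b')) * iota b -
   (iota (D a) - x * iota (D b)) * iota b' =
   (x * iota b' * iota (D b) + iota b * iota (D a')) -
   (x * iota b * iota (D b') + iota b' * iota (D a)) by ring.
by rewrite -h subrr.
Qed.

Lemma frac_der_iota r : frac_der (iota r) = iota (D r).
Proof.
rewrite (@frac_derE _ r 1) ?rmorph1 ?oner_eq0 ?mulr1 //.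
by rewrite (leibniz1 D_mul) rmorph0 mulr0 subr0 divr1.
Qed.

Lemma frac_der_add x y : frac_der (x + y) = frac_der x + frac_der y.
Proof.
have [[a b] /= [b0 e]] := fracP x; have [[c s] /= [s0 f]] := fracP y.
rewrite (@frac_derE (x + y) (a * s + c * b) (b * s)); last first.
- by rewrite rmorphD !rmorphM -e -f; ring.
- by rewrite rmorphM mulf_neq0.
rewrite (frac_derE b0 e) (frac_derE s0 f) D_add !D_mul !rmorphD !rmorphM /= -e -f.
by field; rewrite b0 s0.
Qed.

Lemma frac_der_mul x y : frac_der (x * y) = x * frac_der y + y * frac_der x.
Proof.
have [[a b] /= [b0 e]] := fracP x; have [[c s] /= [s0 f]] := fracP y.
rewrite (@frac_derE (x * y) (a * c) (b * s)); last first.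
- by rewrite !rmorphM -e -f; ring.
- by rewrite rmorphM mulf_neq0.
rewrite (frac_derE b0 e) (frac_derE s0 f) !D_mul !rmorphD !rmorphM /= -e -f.
by field; rewrite b0 s0.
Qed.

End FractionDerivation.

(** * Logarithmic derivations of a discrete valuation ring *)

Section UniformizerMultiple.

Variables (R : comNzRingType) (K : fieldType) (iota : {rmorphism R -> K}).
Variable v : K -> int.
Hypothesis dv : discrete_valuation v.
Hypothesis intP : forall x, (exists r, x = iota r) <-> (x = 0 \/ (0 <= v x)%R).

Lemma valuation_fracP x : exists ab : R * R,
  iota ab.2 != 0 /\ x * iota ab.2 = iota ab.1.
Proof.
have [h|] := boolP (val_int v x).
  have [r ->] := val_intP intP _ h.
  by exists (r, 1); rewrite rmorph1 oner_eq0 mulr1.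
rewrite /val_int negb_or -ltNge => /andP[x0 vx].
have : val_int v x^-1 by rewrite /val_int dvalV // oppr_ge0 ltW ?orbT.
move/(val_intP intP) => [r e]; exists (1, r); rewrite -e rmorph1.
by rewrite invr_eq0 x0 mulfV.
Qed.

Variable d : K -> K.
Hypothesis d_mul : forall a b, d (a * b) = a * d b + b * d a.
Hypothesis d_int : forall a, val_int v a -> val_int v (d a).

(** Multiplying a derivation by a uniformizer [t] makes it logarithmic: write an
    element as a power of [t] times a unit. *)
Lemma log_uniformizer_mul t : v t = 1 -> t != 0 ->
  forall a, a != 0 -> val_int v (t * d a / a).
Proof.
move=> vt t0.
have vt_int : val_int v t by rewrite /val_int vt orbT.
have pos n a : a != 0 -> v a = n%:Z -> val_int v (t * d a / a).
  elim: n a => [|n ih] a a0 va.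
    apply: (val_intM dv); last by rewrite /val_int dvalV // va orbT.
    by apply: (val_intM dv) => //; apply: d_int; rewrite /val_int va orbT.
  have b0 : a / t != 0 by rewrite mulf_neq0 ?invr_eq0.
  have vb : v (a / t) = n%:Z by rewrite dval_div // va vt; lia.
  have -> : t * d a / a = d t + t * d (a / t) / (a / t).
    have -> : d a = a / t * d t + t * d (a / t) by rewrite -d_mul divfK.
    by field; rewrite a0 t0.
  by apply: (val_intD dv); [apply: d_int | apply: ih].
move=> a a0; have [va|va] := leP 0 (v a); first by apply: (pos `|v a|%N); lia.
have ai0 : a^-1 != 0 by rewrite invr_eq0.
have -> : t * d a / a = - (t * d a^-1 / a^-1).
  have /eqP : a * d a^-1 + a^-1 * d a = 0 by rewrite -d_mul mulfV // leibniz1.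
  rewrite addr_eq0 => /eqP e.
  have -> : t * d a^-1 / a^-1 = t * (a * d a^-1) by rewrite invrK; ring.
  by rewrite e; ring.
by apply: (val_intN dv); apply: (pos `|v a|%N) => //; rewrite dvalV //; lia.
Qed.

End UniformizerMultiple.

(** * The module of differentials of the integral closure *)

Theorem proposition3p4 (R : idomainType) (m : {pred R})
    (k : fieldType) (i : {rmorphism k -> R}) (D : R -> R)
    (F : fieldType) (j : {rmorphism {fraction R} -> F})
    (hR : discrete_valuation_ring m)
    (hk : [pchar k] =i pred0)
    (hD : derivation i (D : R -> R^o))
    (hD0 : exists x, D x != 0)
    (hF : forall x : F, algebraicOver j x) :
  let Omega : lmodType (frac_closure j) := kaehler (frac_closure_alg i j) in
  exists phi : {linear restr Omega (frac_closure_in j) -> R^o},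
    exists w, phi w != 0.
Proof.
move=> Omega.
case: hR => v [dv intP _]; case: hD => D_add D_lin D_mul; case: hD0 => x0 Dx0.
pose K : fieldType := {fraction R}; rewrite -/K in v dv intP *.
pose iota : {rmorphism R -> K} := @FracField.tofrac R.
have iota_inj : injective iota by move=> a b /eqP; rewrite tofrac_eq => /eqP.
have char0 : [pchar K] =i pred0.
  by move=> p; rewrite (fmorph_pchar (iota \o i)) hk.
have v_nat n : v n.+1%:R = 0.
  have nk : n.+1%:R != 0 :> k by have /pcharf0P -> := hk.
  have nK : n.+1%:R != 0 :> K by have /pcharf0P -> := char0.
  have h1 : val_int v n.+1%:R.
    by apply/(val_intP intP); exists (n.+1%:R); rewrite rmorph_nat.
  have h2 : val_int v (n.+1%:R)^-1.
    apply/(val_intP intP); exists (i (n.+1%:R)^-1).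
    by rewrite -[RHS]/((iota \o i) _) fmorphV rmorph_nat.
  by move: h1 h2; rewrite /val_int invr_eq0 (negPf nK) dvalV //; move: (v _) => z /=; lia.
have fracP := valuation_fracP dv intP.
have D_mul' a b : D (a * b) = a * D b + b * D a by apply: D_mul.
pose d0 := frac_der fracP D.
have d0_add a b : d0 (a + b) = d0 a + d0 b := frac_der_add fracP D_add D_mul' iota_inj a b.
have d0_mul a b : d0 (a * b) = a * d0 b + b * d0 a :=
  frac_der_mul fracP D_mul' iota_inj a b.
have d0_iota r : d0 (iota r) = iota (D r) := frac_der_iota fracP D_mul' iota_inj r.
have [t t0 vt] := dval_surj dv 1.
pose d x := t * d0 x.
have d_add a b : d (a + b) = d a + d b by rewrite /d d0_add mulrDr.
have d_mul a b : d (a * b) = a * d b + b * d a by rewrite /d d0_mul; ring.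
have d_log a : a != 0 -> val_int v (d a / a).
  apply: (log_uniformizer_mul dv d0_mul) => // {}a /(val_intP intP)[r ->].
  by rewrite d0_iota; apply/(val_intP intP); exists (D r).
pose del := der_ext hF d.
have del_int := log_der_integral dv intP v_nat hF char0 d_add d_mul d_log.
pose B := frac_closure j.
pose dB (b : B) : B^o := IntegralClosure
  (introT (integral_predP _ _) (del_int _ (elimT (integral_predP _ _) (intcl_valP b)))).
have dB_der : derivation (frac_closure_alg i j) dB.
  split=> [a b|c a|a b]; apply: val_inj => /=.
  - exact: der_ext_add.
  - rewrite der_ext_mul //= der_ext_base //.
    have Dc : D (i c) = 0.
      by have := D_lin c 1; rewrite mulr1 (leibniz1 D_mul') scaler0.
    by rewrite /d d0_iota Dc rmorph0 mulr0 rmorph0 mulr0 addr0.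
  - exact: der_ext_mul.
(* The regular module [B^o] is the target: the derivation stays inside [B]. *)
have [h hE _] := kaehler_universal dB_der.
have tr_int (w : Omega) : exists r, ntrace hF (val (h w : B)) = iota r.
  apply/(val_intP intP)/(ntrace_val_int dv intP v_nat) => //.
  exact: (elimT (integral_predP _ _) (intcl_valP (h w))).
pose phi (w : restr Omega (frac_closure_in j)) : R^o := projT1 (cid (tr_int w)).
have phiE w : iota (phi w) = ntrace hF (val (h w : B)).
  by rewrite /phi; case: cid.
have phi_lin : linear phi.
  move=> r u w; apply: iota_inj; rewrite rmorphD rmorphM /= !phiE.
  rewrite -ntrace_scale // -ntrace_add //; congr ntrace.
  by rewrite linearD linearZ.
pose phiL := GRing.isLinear.Build R (restr Omega (frac_closure_in j)) R^o *:%R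
  phi phi_lin.
pose phil : {linear restr Omega (frac_closure_in j) -> R^o} := HB.pack phi phiL.
(* On an element [x0] of [R] the map takes the value [t * D x0]. *)
exists phil, (kaehler_d (frac_closure_alg i j) (frac_closure_in j x0)).
apply: contra_neqN Dx0 => /eqP e; apply: iota_inj; rewrite rmorph0.
have := congr1 iota e; rewrite phiE hE /= der_ext_base // ntrace_base // rmorph0.
by rewrite /d d0_iota => /eqP; rewrite mulf_eq0 (negPf t0) => /eqP.
Qed.
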